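(* For every real number $k>1$ there exists $\varepsilon\in(0,\tfrac12)$ with $k(1-2\varepsilon)^2>1$ (so that, with $a=2k(1-\varepsilon)$ and $b=2k\varepsilon$, partial recovery in the random stochastic block model $G(n,a/n,b/n)$ is possible), and yet there exists a (possibly randomized) monotone adversary such that, in the resulting semirandom block model, for every $\eta>\tfrac12$, no estimator of the spins (i.e.\ no function of the observed graph) achieves $\eta$-partial recovery with probability greater than $o(1)$ as $n\to\infty$. In particular, partial recovery in this semirandom model is information-theoretically impossible.
   Context: Stochastic block model $G(n,a/n,b/n)$ with constants $a>b>0$: each of $n$ vertices independently receives a spin $\sigma_v\in\{+1,-1\}$ uniformly at random; then each unordered pair $\{u,v\}$ is an edge independently with probability $a/n$ if $\sigma_u=\sigma_v$ and $b/n$ otherwise. Write $k=\frac{a+b}{2}$ and $\varepsilon=\frac{b}{a+b}$. Semirandom block model: sample a precursor graph $G_{\mathrm{pre}}\sim G(n,a/n,b/n)$; a monotone adversary, who sees $G_{\mathrm{pre}}$ and the spins, may delete any number of edges joining vertices of opposite spins and add any number of edges joining vertices of equal spin; the resulting graph $G$ is observed. An assignment $\hat\sigma\in\{\pm1\}^n$ achieves $\eta$-partial recovery if at least $\eta n$ of its entries agree with the true spins, possibly after a global sign flip of $\hat\sigma$. An algorithm achieves partial recovery if for some $\eta>\frac12$ it achieves $\eta$-partial recovery with probability $1-o(1)$ as $n\to\infty$. (It is known that partial recovery is possible in the random model when $k(1-2\varepsilon)^2>1$.) *)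

(* Defs.v *)
From HB Require Import structures.
From mathcomp Require Import all_boot all_order all_algebra.
From mathcomp Require Import all_classical all_reals all_analysis.
Set Implicit Arguments.
Unset Strict Implicit.
Unset Printing Implicit Defensive.
Import Order.TTheory GRing.Theory Num.Theory.
Import numFieldNormedType.Exports.
Local Open Scope ring_scope.

(* [true] encodes the spin +1 and [false] the spin -1. *)
Notation spins n := {ffun 'I_n -> bool}.

Notation vpair n := {e : {set 'I_n} | #|e| == 2%N}.

Notation graph n := {set vpair n}.

Definition same_spin (n : nat) (s : spins n) (e : vpair n) : bool :=
  [forall u in val e, forall v in val e, s u == s v].

(* c / n is a probability only once c <= n; for the finitely many smaller n
   it is truncated at 1, which does not affect limits as n tends to infinity. *)
Definition edge_prob (R : realType) (c : R) (n : nat) : R :=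
  Num.min 1 (c / n%:R).

Definition pair_prob (R : realType) (a b : R) (n : nat) (s : spins n)
    (e : vpair n) : R :=
  if same_spin s e then edge_prob a n else edge_prob b n.

(* Joint probability mass function of the spins and the graph of
   G(n, a/n, b/n). *)
Definition sbm (R : realType) (a b : R) (n : nat) (s : spins n)
    (G : graph n) : R :=
  2^-1 ^+ n *
  \prod_(e : vpair n)
    (if e \in G then pair_prob a b s e else 1 - pair_prob a b s e).

Definition monotone_change (n : nat) (s : spins n) (Gpre G : graph n) : bool :=
  [forall e : vpair n,
    if same_spin s e then (e \in Gpre) ==> (e \in G)
    else (e \in G) ==> (e \in Gpre)].

(* [adv s Gpre] is the probability mass function of the observed graph that
   the adversary draws after seeing the spins and the precursor graph; a
   deterministic adversary is the special case of point masses. *)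
Record monotone_adversary (R : realType) (n : nat) := MonotoneAdversary {
  adv :> spins n -> graph n -> graph n -> R;
  adv_ge0 : forall s Gpre G, 0 <= adv s Gpre G;
  adv_sum1 : forall s Gpre, \sum_(G : graph n) adv s Gpre G = 1;
  adv_monotone : forall s Gpre G,
    adv s Gpre G != 0 -> monotone_change s Gpre G }.

Definition semirandom (R : realType) (a b : R) (n : nat)
    (A : monotone_adversary R n) (s : spins n) (G : graph n) : R :=
  \sum_(Gpre : graph n) sbm a b s Gpre * A s Gpre G.

Definition agreement (n : nat) (s t : spins n) : nat :=
  #|[set v | t v == s v]|.

Definition flip (n : nat) (t : spins n) : spins n := [ffun v => ~~ t v].

Definition partial_recovery (R : realType) (eta : R) (n : nat)
    (s t : spins n) : bool :=
  (eta * n%:R <= (agreement s t)%:R) ||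
  (eta * n%:R <= (agreement s (flip t))%:R).

Definition estimator := forall n : nat, graph n -> spins n.

Definition recovery_prob (R : realType) (a b : R)
    (A : forall n : nat, monotone_adversary R n) (eta : R) (est : estimator)
    (n : nat) : R :=
  \sum_(s : spins n)
    \sum_(G : graph n | partial_recovery eta s (est n G))
      semirandom a b (A n) s G.

Definition achieves_partial_recovery (R : realType) (a b : R)
    (A : forall n : nat, monotone_adversary R n) (est : estimator) : Prop :=
  exists2 eta : R, 1 / 2 < eta &
    (recovery_prob a b A eta est n @[n --> \oo] --> (1 : R))%classic.

(* Main.v *)
(* Fix a set W containing a small constant fraction of the vertices. For each v
   in W the adversary looks at the edges joining v to the complement of W; when
   there are exactly two of them and both join opposite spins, it deletes both
   with a fixed probability. Given the spins, the observed graph is a product over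
   blocks (the stars of the vertices of W, and single edges), so the second
   moment of its likelihood against a product reference law factorises. For
   typical spins s, t it depends essentially on the overlap r = s t only.

   Without the adversary this second moment is E exp(k th^2 (sum r)^2 / 2n) with
   th = 1 - 2 eps, hence critical at k th^2 = 1. Averaged over r v, the star of v
   contributes the extra factor exp(- c m^2), where m is the mean of r outside W,
   and this pushes the critical point strictly beyond 1.

   A high even power of the overlap between s and an estimate is expanded over
   tuples of vertices and bounded by Cauchy-Schwarz by the second moment weighted
   by the same power of sum r. With a power of order n, the gain is exponential
   and absorbs the exp(o(n)) errors made for typical spins. *)
Require Import Defs.
From HB Require Import structures.
From mathcomp Require Import all_boot all_order all_algebra.
From mathcomp Require Import all_classical all_reals all_analysis.
From mathcomp Require Import fintype finset ring lra.
Set Implicit Arguments.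
Unset Strict Implicit.
Unset Printing Implicit Defensive.
Import Order.TTheory GRing.Theory Num.Theory.
Import numFieldNormedType.Exports.
Local Open Scope ring_scope.

(** To leading order, a star with two edges of signs [x], [x'] has after the deletions the
    likelihood [(1 - chi) + (th + chi) (x + x') + (th ^ 2 - chi) x x'], where [chi] measures the
    deletions. The product term, which links the two outer neighbours, is weakened. The linear
    terms, which link them to the centre, are strengthened, but in the second moment they are odd in
    the overlap at the centre and average out. Only the interaction inside [W] biases this average.
    If [W] has the proportion [dl] of the vertices, the bias costs order [dl ^ 2] against a gain of
    order [dl]; hence [W] is small but of fixed proportion, and the admissible excess [x] over the
    threshold is small compared with [dl].

    The error [kap] of one star does not vanish with [n], so all stars together cost a factor
    exponential in [n]. However, [kap] is proportional to the bound [z] on the mean magnetization of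
    typical spins, and [z] enters only the analysis. It can be chosen after the adversary and after
    [eta], which is why one adversary serves every [eta]. *)

(** * Elementary estimates for the exponential and the hyperbolic cosine *)

Section Exponential.
Variable R : realType.
Implicit Types x y : R.

Lemma expR_add_expRN_sqr x :
  expR x + expR (- x) - 2 = (expR (x / 2) - expR (- (x / 2))) ^+ 2.
Proof.
have -> : expR x = expR (x / 2) ^+ 2.
  by rewrite -expRM_natr; congr expR; field.
have -> : expR (- x) = expR (- (x / 2)) ^+ 2.
  by rewrite -expRM_natr; congr expR; field.
have h : expR (x / 2) * expR (- (x / 2)) = 1 by rewrite expRxMexpNx_1.
rewrite sqrrB h; ring.
Qed.

(** This is the upper bound [1 / (1 - x)] on the exponential, freed of the division so that it holds
    for every [x]. *)
Lemma expR_mul_le1 x : expR x * (1 - x) <= 1.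
Proof.
have h : expR x * expR (- x) = 1 by rewrite expRxMexpNx_1.
have := expR_ge1Dx (- x); have := expR_gt0 x; nra.
Qed.

Definition coshR x := (expR x + expR (- x)) / 2.

Lemma coshR_ge1 x : 1 <= coshR x.
Proof.
have := expR_add_expRN_sqr x; have := sqr_ge0 (expR (x / 2) - expR (- (x / 2))).
rewrite /coshR; lra.
Qed.

Lemma coshR_double x : coshR (x * 2) = 2 * coshR x ^+ 2 - 1.
Proof.
have h : expR x * expR (- x) = 1 by rewrite expRxMexpNx_1.
rewrite /coshR.
have -> : expR (x * 2) = expR x ^+ 2 by rewrite -expRM_natr.
have -> : expR (- (x * 2)) = expR (- x) ^+ 2.
  by rewrite -expRM_natr; congr expR; ring.
have -> : (((expR x + expR (- x)) / 2) ^+ 2 =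
  (expR x ^+ 2 + expR (- x) ^+ 2 + 2 * (expR x * expR (- x))) / 4) by field.
by rewrite h; field.
Qed.

Lemma coshR_double_le x : coshR (x * 2) <= coshR x ^+ 4.
Proof.
rewrite coshR_double (_ : 4 = 2 * 2)%N // exprM.
have := sqr_ge0 (coshR x ^+ 2 - 1); nra.
Qed.

(** The relative error [2 * x] is harmless: at [x / 2 ^ i] and raised to the power [4 ^ i], it
    contributes only [x ^ 3 / 2 ^ i] to the exponent. *)
Lemma coshR_small x : 0 <= x <= 1 -> coshR x <= expR (x ^+ 2 / 2 * (1 + 2 * x)).
Proof.
move=> /andP[x0 x1]; apply: le_trans (expR_ge1Dx _).
have e := expR_add_expRN_sqr x.
have a := expR_mul_le1 (x / 2); have b := expR_ge1Dx (- (x / 2)).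
have c : 1 <= expR (x / 2) by have := expR_ge1Dx (x / 2); lra.
have d : expR (- (x / 2)) <= 1 by rewrite expR_le1; lra.
set u := expR (x / 2) in e a c *; set v := expR (- (x / 2)) in e b d *.
have u2 : u <= 1 + x / 2 + x ^+ 2 / 2 by nra.
have w : u - v <= x + x ^+ 2 / 2 by nra.
have w0 : 0 <= u - v by nra.
have w2 : (u - v) ^+ 2 <= (x + x ^+ 2 / 2) ^+ 2 by rewrite lerXn2r ?nnegrE //; nra.
have w3 : (x + x ^+ 2 / 2) ^+ 2 <= x ^+ 2 * (1 + 2 * x).
  have -> : (x + x ^+ 2 / 2) ^+ 2 = x ^+ 2 * (1 + x + x ^+ 2 / 4) by field.
  by apply: ler_wpM2l; nra.
by rewrite /coshR; lra.
Qed.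

Lemma coshR_iter x i : coshR x <= coshR (x / 2 ^+ i) ^+ (4 ^ i).
Proof.
elim: i => [|i IH]; first by rewrite expr0 divr1 expn0 expr1.
apply: le_trans IH _.
have -> : x / 2 ^+ i = x / 2 ^+ i.+1 * 2 by rewrite exprS; field.
rewrite expnS exprM lerXn2r ?nnegrE ?coshR_double_le //.
- by have := coshR_ge1 (x / 2 ^+ i.+1 * 2); lra.
- by apply: exprn_ge0; have := coshR_ge1 (x / 2 ^+ i.+1); lra.
Qed.

(* Doubling the argument only loses (e - 1)^2 >= 0, so it is enough to compare
   the two sides infinitesimally. *)
Lemma coshR_le_expR x : coshR x <= expR (x ^+ 2 / 2).
Proof.
wlog x0 : x / 0 <= x.
  move=> H; have [/H //|] := leP 0 x => x0.
  have -> : coshR x = coshR (- x) by rewrite /coshR opprK addrC.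
  by rewrite -sqrrN; apply: H; lra.
rewrite -ler_ln ?posrE ?expR_gt0 ?expRK; last by have := coshR_ge1 x; lra.
apply/ler_addgt0Pr => e e0.
have [i hi] : exists i : nat, x * (1 + x ^+ 2) <= e * 2 ^+ i /\ x <= 2 ^+ i.
  have [i hi] : exists i : nat, x * (1 + x ^+ 2) / e + x <= i%:R.
    by exists (Num.truncn (x * (1 + x ^+ 2) / e + x)).+1; exact: ltW (truncnS_gt _).
  exists i.
  have h2 : (i%:R : R) <= 2 ^+ i by rewrite -natrX ler_nat ltnW // ltn_expl.
  have y0 : 0 <= x * (1 + x ^+ 2) / e.
    by apply: divr_ge0; [nra|lra].
  split; last lra.
  have : x * (1 + x ^+ 2) / e <= 2 ^+ i by lra.
  by rewrite ler_pdivrMr // (mulrC e).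
have P0 : 0 < 2 ^+ i :> R by rewrite exprn_gt0.
set y := x / 2 ^+ i.
have y01 : 0 <= y <= 1.
  by rewrite /y divr_ge0 ?(ltW P0) //= ler_pdivrMr // mul1r; case: hi.
rewrite -[leRHS]expRK ler_ln ?posrE ?expR_gt0 //; last first.
  by have := coshR_ge1 x; lra.
apply: le_trans (coshR_iter x i) _; rewrite -/y.
apply: le_trans (_ : expR (y ^+ 2 / 2 * (1 + 2 * y)) ^+ (4 ^ i) <= _).
  rewrite lerXn2r ?nnegrE ?coshR_small ?expR_ge0 //.
  by have := coshR_ge1 y; lra.
rewrite -expRM_natr ler_expR natrX.
have -> : y ^+ 2 / 2 * (1 + 2 * y) * 4 ^+ i = x ^+ 2 / 2 + x ^+ 3 / 2 ^+ i.
  have -> : (4 : R) ^+ i = 2 ^+ i * 2 ^+ i by rewrite -exprMn; congr (_ ^+ _); ring.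
  by rewrite /y; field; rewrite gt_eqF.
rewrite lerD2l ler_pdivrMr //.
by case: hi => hi _; nra.
by have := coshR_ge1 x; lra.
Qed.

End Exponential.

(** * Sums over the subsets of a finite set *)

Section FiniteSums.
Variable R : realType.

(** A set is determined by its traces on the fibres of [l], and these traces can be prescribed
    freely. In the applications this is the independence of the blocks. *)
Lemma sum_blocks (E L : finType) (l : E -> L) (F : L -> {set E} -> R) :
  \sum_(G : {set E}) \prod_(i : L) F i (G :&: [set e | l e == i]) =
  \prod_(i : L) \sum_(N : {set E} | N \subset [set e | l e == i]) F i N.
Proof.
rewrite bigA_distr_big_dep.
rewrite (reindex_onto
  (fun G : {set E} => [ffun i => G :&: [set e | l e == i]])
  (fun f : {ffun L -> {set E}} => [set e | e \in f (l e)])) /=.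
  apply: eq_big => [G|G _].
    rewrite (_ : _ \in _ = true); last first.
      by apply/familyP => i; rewrite ffunE unfold_in subsetIr.
    apply/esym/eqP/setP => e; rewrite !inE ffunE !inE eqxx andbT //.
  by apply: eq_bigr => i _; rewrite ffunE.
move=> f /familyP hf; apply/ffunP => i; rewrite ffunE; apply/setP => e.
rewrite !inE; have := hf i; rewrite unfold_in => /subsetP h.
case: eqP => [<-|ne]; first by rewrite andbT.
rewrite andbF; apply/esym/negbTE/negP => /h; rewrite inE => /eqP //.
Qed.

(** Distribute the product after extending the factors outside [B] by [0 + 1]: every set that leaves
    [B] then picks up a factor zero. *)
Lemma sum_subset_prod (E : finType) (B : {set E}) (f g : E -> R) :
  \sum_(N : {set E} | N \subset B) \prod_(e in B) (if e \in N then f e else g e) =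
  \prod_(e in B) (f e + g e).
Proof.
rewrite [RHS]big_mkcond /=.
under [RHS]eq_bigr => e _.
  rewrite (_ : (if _ then _ else _) =
    (if e \in B then f e else 0) + (if e \in B then g e else 1)); last first.
    by case: ifP; rewrite ?add0r.
  over.
rewrite bigA_distr [RHS](bigID (fun N : {set E} => N \subset B)) /=.
rewrite [X in _ = _ + X]big1 ?addr0; last first.
  move=> N /subsetPn[e eN eB].
  by rewrite (bigD1 e) //= eN (negbTE eB) mul0r.
apply: eq_bigr => N NB; rewrite [LHS]big_mkcond; apply: eq_bigr => e _.
case: (boolP (e \in B)) => // eB; case: ifP => // eN.
by rewrite (subsetP NB) in eB.
Qed.

(** Newton's identity for the second elementary symmetric polynomial: off the diagonal, the square
    meets each two-element set twice, as [(a, b)] and as [(b, a)]. *)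
Lemma sum_card2_prod (E : finType) (B : {set E}) (g : E -> R) :
  \sum_(N : {set E} | (N \subset B) && (#|N| == 2)%N) \prod_(e in N) g e =
  ((\sum_(e in B) g e) ^+ 2 - \sum_(e in B) g e ^+ 2) / 2.
Proof.
have -> : (\sum_(e in B) g e) ^+ 2 =
    \sum_(q : E * E | (q.1 \in B) && (q.2 \in B)) g q.1 * g q.2.
  rewrite expr2 big_distrl /= -(pair_big (mem B) (mem B) (fun i j => g i * g j)) /=.
  by apply: eq_bigr => i _; rewrite big_distrr.
rewrite (bigID (fun q : E * E => q.1 == q.2)) /=.
have -> : \sum_(q : E * E | (q.1 \in B) && (q.2 \in B) && (q.1 == q.2)) g q.1 * g q.2 =
    \sum_(e in B) g e ^+ 2.
  rewrite (reindex_onto (fun e => (e, e)) fst) /=; last first.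
    by case=> a b /= /andP[_ /eqP ->].
  by apply: eq_big => [e|e _]; rewrite ?eqxx ?andbT ?andbb // expr2.
rewrite (partition_big (fun q : E * E => [set q.1; q.2])
  (fun N : {set E} => (N \subset B) && (#|N| == 2)%N)) /=; last first.
  case=> a b /= /andP[/andP[aB bB] ab]; rewrite cards2 ab eqxx andbT.
  by apply/subsetP => z; rewrite !inE => /orP[]/eqP->.
rewrite addrC addrK big_distrl /=; apply: esym.
apply: eq_bigr => N /andP[NB /cards2P[a [b [ab eN]]]]; subst N.
have [aB bB] : a \in B /\ b \in B.
  by split; apply: (subsetP NB); rewrite !inE eqxx ?orbT.
rewrite (eq_bigl (mem [set (a, b); (b, a)])); last first.
  case=> i j /=; rewrite !inE !xpair_eqE.
  apply/idP/idP.
    move=> /andP[/andP[/andP[iB jB] ij] /eqP/setP e].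
    have := e a; have := e b; have := e i; have := e j; rewrite !inE !eqxx ?orbT /=.
    move=> /esym/orP[]/eqP ej /esym/orP[]/eqP ei; subst i j;
      rewrite ?eqxx ?orbT //=; by rewrite eqxx in ij.
  case/orP => /andP[/eqP-> /eqP->]; first by rewrite aB bB ab eqxx.
  by rewrite aB bB eq_sym ab setUC eqxx.
have nin : (a, b) \notin [set (b, a)] by rewrite inE xpair_eqE negb_and ab.
rewrite (eq_bigl (mem ((a, b) |: [set (b, a)]))) //.
by rewrite big_setU1 //= big_set1 /= big_setU1 ?inE //= big_set1; field.

Qed.

End FiniteSums.

(** * Real inequalities for the second moment of one star *)

Section Bracket.
Variable R : realType.
Implicit Types (S T np w y mu eta th chi : R).

(** This is the share of the empty star. As [T], [T'] and [np] all lie near [mu], the product of the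
    two differences is of second order and the quotient is [mu] up to a relative error of order
    [eta]. *)
Lemma bracket_empty_le T T' np w mu eta : 0 < mu -> 0 < eta -> 4 * eta <= 1 ->
  `|T - mu| <= mu * eta -> `|T' - mu| <= mu * eta ->
  0 <= w <= 1 -> mu * (1 - eta) <= np <= mu ->
  (T * T' - w * (T - np) * (T' - np)) / np <= mu * (1 + 10 * eta).
Proof.
move=> mu0 z0 z1; rewrite !ler_norml => /andP[t1 t2] /andP[t3 t4] /andP[w0 w1] /andP[n0 n1].
have np0 : 0 < np by apply: lt_le_trans n0; rewrite mulr_gt0 //; lra.
have me : 0 <= mu * eta by rewrite mulr_ge0 // ltW.
have me4 : 4 * (mu * eta) <= mu by rewrite mulrCA -[leRHS]mulr1 ler_pM2l.
rewrite ler_pdivrMr //.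
have d1 : `|T - np| <= 2 * (mu * eta) by rewrite ler_norml; apply/andP; split; lra.
have d2 : `|T' - np| <= 2 * (mu * eta) by rewrite ler_norml; apply/andP; split; lra.
have d3 : - (w * (T - np) * (T' - np)) <= (2 * (mu * eta)) * (2 * (mu * eta)).
  rewrite -mulrA; apply: le_trans (ler_norm _) _; rewrite normrN normrM (ger0_norm w0).
  rewrite normrM -[leRHS]mul1r; apply: ler_pM => //.
  exact: ler_pM.
have d4 : T * T' <= (mu * (1 + eta)) * (mu * (1 + eta)).
  have T0 : 0 <= T by lra.
  have T0' : 0 <= T' by lra.
  by apply: ler_pM => //; lra.
have d5 : mu * (1 + 10 * eta) * (mu * (1 - eta)) <= mu * (1 + 10 * eta) * np.
  by apply: ler_wpM2l => //; rewrite mulr_ge0 ?(ltW mu0) //; lra.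
apply: le_trans (lerD d4 d3) (le_trans _ d5).
rewrite -subr_ge0.
have -> : mu * (1 + 10 * eta) * (mu * (1 - eta)) - (mu * (1 + eta) * (mu * (1 + eta)) +
  2 * (mu * eta) * (2 * (mu * eta))) = mu ^+ 2 * (eta * (7 - 15 * eta)) by ring.
by rewrite mulr_ge0 ?sqr_ge0 // mulr_ge0 //; lra.
Qed.

(* [S1], [S2], [S2'] and [S3] are the mixed second moments, [T], [T'] the two first
   moments and [mu] their common scale. *)
Lemma bracket_le th chi S1 S2 S2' S3 T T' np w y mu eta :
  0 <= chi -> chi <= 1 / 2 -> 0 < mu -> 0 < eta -> 4 * eta <= 1 ->
  `|S1 - mu * (1 + th * th * y) ^+ 2| <= mu * eta ->
  `|S2 - mu * (1 + th * -1 * y) ^+ 2| <= mu * eta ->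
  `|S2' - mu * (1 + -1 * th * y) ^+ 2| <= mu * eta ->
  `|S3 - mu * (1 + -1 * -1 * y) ^+ 2| <= mu * eta ->
  `|T - mu| <= mu * eta -> `|T' - mu| <= mu * eta ->
  0 <= w <= 1 -> mu * (1 - eta) <= np <= mu ->
  (S1 - S2 - S2' + S3) / (1 - chi) - S3 +
    (T * T' - w * (T - np) * (T' - np)) / np <=
  mu * (2 * ((1 + th) ^+ 2 / (1 - chi) - 1) * y -
    (2 * th ^+ 2 - th ^+ 4 - chi) / (1 - chi) * y ^+ 2 + 20 * eta).
Proof.
move=> c0 c1 mu0 z0 z1 h1 h2 h3 h4 t1 t2 w01 n01.
have ch : 0 < 1 - chi by lra.
apply: le_trans (lerD (lexx _) (bracket_empty_le mu0 z0 z1 t1 t2 w01 n01)) _.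
move=> {t1 t2 w01 n01}.
have me : 0 <= mu * eta by rewrite mulr_ge0 // ltW.
(* At the leading values the terms free of [y] cancel: the four pair moments give [1 - 1 - 1 + 1],
   and the last pair moment cancels against the empty star. This is the benefit of the reference
   law. *)
have -> : mu * (2 * ((1 + th) ^+ 2 / (1 - chi) - 1) * y -
    (2 * th ^+ 2 - th ^+ 4 - chi) / (1 - chi) * y ^+ 2 + 20 * eta) =
  (mu * (1 + th * th * y) ^+ 2 - mu * (1 + th * -1 * y) ^+ 2 - mu * (1 + -1 * th * y) ^+ 2
    + mu * (1 + -1 * -1 * y) ^+ 2) / (1 - chi) - mu * (1 + -1 * -1 * y) ^+ 2 + mu
    + 20 * (mu * eta).
  by field; rewrite gt_eqF.
move: h1 h2 h3 h4.
move: (mu * (1 + th * th * y) ^+ 2) (mu * (1 + th * -1 * y) ^+ 2) (mu * (1 + -1 * th * y) ^+ 2)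
  (mu * (1 + -1 * -1 * y) ^+ 2) => A1 A2 A3 A4.
rewrite !ler_norml => /andP[_ h1] /andP[h2 _] /andP[h3 _] /andP[h4 h5].
have first : (S1 - S2 - S2' + S3) / (1 - chi) <= (A1 - A2 - A3 + A4) / (1 - chi) + 8 * (mu * eta).
  rewrite ler_pdivrMr // mulrDl divfK ?gt_eqF //.
  have : 0 <= mu * eta * (1 / 2 - chi) by rewrite mulr_ge0 //; lra.
  by lra.
by move: first; move: (_ / _) (_ / _) => u v; lra.
Qed.

Lemma mul_empty_ratio_close (kk z e e' : R) : 1 <= kk -> 0 < z ->
  4 * kk * (207 * z) <= 1 ->
  (1 - z) * (1 - 2 * kk * z) <= e <= expR (2 * kk * z) ->
  (1 - z) * (1 - 2 * kk * z) <= e' <= expR (2 * kk * z) ->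
  0 <= e * e' /\ `|e * e' - 1| <= kk * (207 * z).
Proof.
move=> k1 z0 kz /andP[e1 e2] /andP[e3 e4].
have kz0 : 0 < kk * z by rewrite mulr_gt0 //; lra.
have kzz : z <= kk * z by rewrite ler_peMl // ltW.
have kze : kk * (207 * z) = 207 * (kk * z) by ring.
have lo : 1 - 3 * (kk * z) <= (1 - z) * (1 - 2 * kk * z).
  have : 0 <= z * (kk * z) by rewrite mulr_ge0 // ltW.
  by lra.
have lo0 : 0 <= 1 - 3 * (kk * z) by lra.
have E0 : 0 <= e by lra.
have E0' : 0 <= e' by lra.
split; first exact: mulr_ge0.
have hi : e * e' <= expR (2 * kk * z) * expR (2 * kk * z) by exact: ler_pM.
have hi2 : expR (2 * kk * z) * expR (2 * kk * z) <= 1 + 8 * (kk * z).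
  rewrite -expRD; have := expR_mul_le1 (2 * kk * z + 2 * kk * z).
  have -> : 1 - (2 * kk * z + 2 * kk * z) = 1 - 4 * (kk * z) by ring.
  move: (expR _) => F hF.
  have d0 : 0 < 1 - 4 * (kk * z) by lra.
  have : F <= 1 / (1 - 4 * (kk * z)) by rewrite ler_pdivlMr.
  move=> /le_trans; apply; rewrite ler_pdivrMr //.
  have : 0 <= (kk * z) * (1 - 8 * (kk * z)) by apply: mulr_ge0; lra.
  by lra.
have lo2 : (1 - 3 * (kk * z)) * (1 - 3 * (kk * z)) <= e * e'.
  by apply: ler_pM => //; lra.
have := sqr_ge0 (kk * z); rewrite kze.
rewrite ler_norml; move: (e * e') (expR _ * _) hi lo2 hi2 => F F' hi lo2 hi2 sq.
by apply/andP; split; lra.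
Qed.

(* Coefficients of [y] and of [- y ^+ 2] in the change of the second moment of a
   star caused by the deletions, [y] being the mean overlap seen from its centre.
   The first one averages out over the spin of the centre. *)
Definition gain1 th chi : R := 2 * ((1 + th) ^+ 2 / (1 - chi) - 1).
Definition gain2 th chi : R := (2 * th ^+ 2 - th ^+ 4 - chi) / (1 - chi).

Lemma gain_bounds th chi : 0 < th -> th < 1 -> 0 <= chi -> chi <= 1 / 2 ->
  (0 <= gain1 th chi <= 14) /\ `|gain2 th chi| <= 6.
Proof.
move=> h0 h1 c0 c1.
have ch : 0 < 1 - chi by lra.
have [iv0 iv1] : 1 <= (1 - chi)^-1 /\ (1 - chi)^-1 <= 2.
  by split; [rewrite invf_ge1 //; lra|rewrite -[leRHS]invrK lef_pV2 ?posrE; lra].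
split.
  rewrite /gain1; have : 1 <= (1 + th) ^+ 2 <= 4 by nra.
  by move: (_ ^+ 2) (_^-1) iv0 iv1 => u v ? ? /andP[? ?]; nra.
have t2 : 0 <= th ^+ 2 <= 1 by nra.
have : `|2 * th ^+ 2 - th ^+ 4 - chi| <= 3.
  rewrite (_ : th ^+ 4 = th ^+ 2 * th ^+ 2); last by ring.
  by move: (th ^+ 2) t2 => u /andP[? ?]; rewrite ler_norml; nra.
move=> h; rewrite /gain2 normrM (ger0_norm (_ : 0 <= (1 - chi)^-1)); last by lra.
by rewrite (_ : 6 = 3 * 2); [apply: ler_pM => //; lra|ring].
Qed.

(** In the application [F] is a product of two empty ratios, [W] the weight of the modified stars
    and [G] the leading change. As [G] may have either sign, the deviation of [F] from one is paid
    additively: [45] is [20] plus a bound [25] on [G + 20 * eta]. *)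
Lemma modified_term_le (F G W kk eta : R) : 1 <= kk -> 0 < eta -> 4 * kk * eta <= 1 ->
  0 <= F -> `|F - 1| <= kk * eta -> `|G| <= 20 -> 0 <= W <= kk ^+ 2 ->
  W * (F * (G + 20 * eta)) <= W * G + 45 * kk ^+ 3 * eta.
Proof.
move=> k1 e0 ke4 F0 F1 G20 /andP[W0 W1].
have ke : 0 < kk * eta by rewrite mulr_gt0 //; lra.
have kee : eta <= kk * eta by rewrite ler_peMl // ltW.
have FG : F * (G + 20 * eta) <= G + 45 * (kk * eta).
  have : (F - 1) * (G + 20 * eta) <= kk * eta * 25.
    apply: le_trans (ler_norm _) _; rewrite normrM; apply: ler_pM => //.
    apply: le_trans (ler_normD _ _) _.
    have -> : `|20 * eta| = 20 * eta by rewrite ger0_norm //; lra.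
    by lra.
  by lra.
apply: le_trans (ler_wpM2l W0 FG) _; rewrite mulrDr lerD2l.
have -> : 45 * kk ^+ 3 * eta = kk ^+ 2 * (45 * (kk * eta)) by ring.
by apply: ler_wpM2r => //; lra.
Qed.

End Bracket.

(** * Law, reference law and second moment of a single block *)

Section Block.
Variables (R : realType) (E : finType).
Implicit Types (B N : {set E}) (c : pred E) (pr : bool -> R).

Definition sgn (b : bool) : R := if b then 1 else -1.

(** The predicate [c] marks the edges joining equal spins, so these are pairs that a monotone
    adversary may delete. *)
Definition crossing_pair c N := (#|N| == 2)%N && [forall e in N, ~~ c e].

Definition cut (g : R) c N0 N : R :=
  if crossing_pair c N0 then g * (N == set0)%:R + (1 - g) * (N == N0)%:R
  else (N == N0)%:R.

Definition block_pre pr B c N : R :=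
  \prod_(e in B) (if e \in N then pr (c e) else 1 - pr (c e)).

Definition block_law g pr B c N : R :=
  \sum_(N0 : {set E} | N0 \subset B) block_pre pr B c N0 * cut g c N0 N.

Lemma cut_ge0 g c N0 N : 0 <= g <= 1 -> 0 <= cut g c N0 N.
Proof.
move=> /andP[g0 g1]; rewrite /cut; case: ifP => _ //.
by rewrite addr_ge0 ?mulr_ge0 ?subr_ge0 //.
Qed.

Lemma cut_sum1 g c B N0 : N0 \subset B -> \sum_(N : {set E} | N \subset B) cut g c N0 N = 1.
Proof.
move=> hN.
have dl : forall M : {set E}, M \subset B -> \sum_(N : {set E} | N \subset B) ((N == M)%:R : R) = 1.
  move=> M MB; rewrite (bigD1 M) //= eqxx big1 ?addr0 // => N /andP[_ /negbTE ->] //.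
rewrite /cut; case: (crossing_pair c N0); last exact: dl.
by rewrite big_split /= -!big_distrr /= !dl ?sub0set // !mulr1; ring.
Qed.

Lemma cut_monotone g c N0 N : cut g c N0 N != 0 ->
  forall e, if c e then (e \in N0) ==> (e \in N) else (e \in N) ==> (e \in N0).
Proof.
rewrite /cut; case: ifP => [/andP[_ /forallP h]|_].
  have [->|_] := eqVneq N N0; first by move=> _ e; rewrite implybb if_same.
  have [->|_] := eqVneq N set0; last by rewrite !mulr0 addr0 eqxx.
  move=> _ e; rewrite inE /=; case: ifP => // ce; apply/implyP => eN.
  by have := h e; rewrite eN ce.
have [-> _ e|_] := eqVneq N N0; first by rewrite implybb if_same.
by rewrite eqxx.
Qed.

Lemma block_pre_ge0 pr B c N : (forall b, 0 <= pr b <= 1) -> 0 <= block_pre pr B c N.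
Proof.
move=> h; apply: prodr_ge0 => e _; have /andP[h0 h1] := h (c e).
by case: ifP; rewrite ?subr_ge0.
Qed.

(** All mass removed from the crossing pairs arrives at the empty set, so the law changes only at
    these sets. *)
Lemma block_lawE g pr B c N : N \subset B ->
  block_law g pr B c N = block_pre pr B c N * (1 - g * (crossing_pair c N)%:R) +
    (N == set0)%:R * (g * \sum_(N0 : {set E} | N0 \subset B)
      block_pre pr B c N0 * (crossing_pair c N0)%:R).
Proof.
move=> NB; rewrite /block_law.
under eq_bigr => N0 _.
  rewrite (_ : _ * _ = (block_pre pr B c N0 * (1 - g * (crossing_pair c N0)%:R)) * (N == N0)%:R
    + (N == set0)%:R * (g * (block_pre pr B c N0 * (crossing_pair c N0)%:R))); last first.
    rewrite /cut; case: ifP => _; rewrite ?mulr1n ?mulr0n; ring.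
  over.
rewrite big_split /= -!big_distrr /=; congr (_ + _).
rewrite (bigD1 N) //= eqxx mulr1 big1 ?addr0 // => M /andP[_ /negbTE].
by rewrite eq_sym => ->; rewrite mulr0.
Qed.

Section ModelConstants.
Variables (p th chi g : R) (pr : bool -> R).
Hypotheses (p0 : 0 < p) (p1 : p <= 1 / 2) (th0 : 0 < th) (th1 : th < 1).
Hypotheses (chi0 : 0 <= chi) (chi1 : chi <= 1 / 2).
Hypothesis prE : forall b, pr b = p * (1 + th * sgn b).

Local Notation tt := (p * th / (1 - p)).
Hypothesis gE : g * (1 - th) ^+ 2 = 4 * chi * (1 + tt) ^+ 2.

Local Notation x c e := (sgn (c e)).

(** Since [1 - p * (1 + th * x) = (1 - p) * (1 - tt * x)], this is the likelihood ratio of a present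
    edge against density [p], divided by that of an absent edge. The ratios for absence are
    collected over the whole block in [empty_ratio]. *)
Definition ratio b : R := (1 + th * sgn b) / (1 - tt * sgn b).

Definition empty_ratio B c : R := \prod_(e in B) (1 - tt * x c e).

Local Notation P0 B N := (p ^+ #|N| * (1 - p) ^+ (#|B| - #|N|)).
Definition pair_ref B := p ^+ 2 * (1 - p) ^+ (#|B| - 2).
Definition npairs B : R := (#|B|%:R ^+ 2 - #|B|%:R) / 2.

(* To leading order, the average of [block_law] over uniform spins: this is what
   cancels the terms of first order in the magnetizations. *)
Definition block_ref B N : R :=
  if (#|N| == 2)%N then (1 - chi) * pair_ref B
  else if N == set0 then (1 - p) ^+ #|B| + chi * pair_ref B * npairs B
  else P0 B N.

Lemma tt_bounds : 0 < tt /\ tt < 1.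
Proof.
have q : 0 < 1 - p by move: p1; lra.
split; first by rewrite divr_gt0 ?mulr_gt0.
by rewrite ltr_pdivrMr // mul1r; move: p0 p1 th0 th1; nra.
Qed.

Lemma npairs_ge0 B : 0 <= npairs B.
Proof.
rewrite /npairs; case: #|B| => [|m]; first by rewrite expr0n /= subrr mul0r.
apply: divr_ge0 => //; rewrite -natr1; have : 0 <= m%:R :> R by []. nra.
Qed.

Lemma pair_ref_gt0 B : 0 < pair_ref B.
Proof. by rewrite mulr_gt0 ?exprn_gt0 //; move: p1; lra. Qed.

Lemma block_ref_gt0 B N : 0 < block_ref B N.
Proof.
have q : 0 < 1 - p by move: p1; lra.
rewrite /block_ref; case: ifP => _; first by rewrite mulr_gt0 ?pair_ref_gt0 //; move: chi1; lra.
case: ifP => _; last by rewrite mulr_gt0 ?exprn_gt0.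
apply: ltr_pwDl; first exact: exprn_gt0.
by rewrite mulr_ge0 ?npairs_ge0 // mulr_ge0 // ltW // pair_ref_gt0.
Qed.

Lemma sum_card2_const B (r : R) :
  \sum_(N : {set E} | (N \subset B) && (#|N| == 2)%N) r = r * npairs B.
Proof.
have := sum_card2_prod B (fun=> 1 : R).
under eq_bigr => N _ do rewrite big1_eq.
under [in X in X = _ -> _]eq_bigr do [].
under [X in _ = (_ - X) / _ -> _]eq_bigr => e _ do rewrite expr1n.
rewrite [\sum_(e in B) 1]sumr_const -[X in _ = (X ^+ 2 - X) / 2 -> _]mulr_natr mul1r => h.
by rewrite /npairs -h big_distrr /=; apply: eq_bigr => N _; rewrite mulr1.
Qed.

Lemma prod_if_const B N (a b : R) : N \subset B ->
  \prod_(e in B) (if e \in N then a else b) = a ^+ #|N| * b ^+ (#|B| - #|N|).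
Proof.
move=> NB; rewrite (big_setID N) /= (setIidPr NB).
have -> : (#|B| - #|N|)%N = #|B :\: N| by rewrite cardsD (setIidPr NB).
congr (_ * _).
  by rewrite (eq_bigr (fun=> a)) ?prodr_const // => e ->.
rewrite (eq_bigr (fun=> b)) ?prodr_const // => e.
by rewrite inE => /andP[/negbTE ->].
Qed.

Lemma sum_P0 B : \sum_(N : {set E} | N \subset B) P0 B N = 1.
Proof.
under eq_bigr => N NB do rewrite -(prod_if_const _ _ NB).
rewrite sum_subset_prod big1 // => e _; ring.
Qed.

(** The adversary changes laws and second moments only at two-element sets and at the empty set;
    this isolates the change. *)
Lemma sum_block_split B (f f' : {set E} -> R) :
  (forall N, N \subset B -> #|N| != 2%N -> N != set0 -> f' N = f N) ->
  \sum_(N : {set E} | N \subset B) f' N = \sum_(N : {set E} | N \subset B) f N +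
  (\sum_(N : {set E} | (N \subset B) && (#|N| == 2)%N) (f' N - f N) + (f' set0 - f set0)).
Proof.
move=> h; apply/eqP; rewrite addrC -subr_eq -sumrB.
rewrite (bigID (fun N : {set E} => #|N| == 2)%N) /=; apply/eqP; congr (_ + _).
rewrite (bigD1 set0) /=; last by rewrite sub0set cards0.
rewrite big1 ?addr0 // => N /andP[/andP[NB N2] N0].
by rewrite h // subrr.
Qed.

Lemma block_ref_sum B : \sum_(N : {set E} | N \subset B) block_ref B N = 1.
Proof.
rewrite (@sum_block_split B (fun N => P0 B N)); last first.
  by move=> N _ /negbTE h2 /negbTE h0; rewrite /block_ref h2 h0.
rewrite sum_P0 (eq_bigr (fun=> - chi * pair_ref B)); last first.
  move=> N /andP[_ /eqP h]; rewrite /block_ref h eqxx /pair_ref; ring.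
rewrite sum_card2_const /block_ref !cards0 eqxx /= subn0 expr0; ring.
Qed.

Lemma block_pre_factor B c N : N \subset B ->
  block_pre pr B c N = P0 B N * (empty_ratio B c * \prod_(e in N) ratio (c e)).
Proof.
move=> NB; have [t0 t1] := tt_bounds.
rewrite -(prod_if_const _ _ NB) /empty_ratio.
rewrite [X in _ * (_ * X)](_ : _ = \prod_(e in B) (if e \in N then ratio (c e) else 1)).
  rewrite -!big_split /=; apply: eq_bigr => e _; rewrite prE /ratio.
  have q : 1 - p != 0 by rewrite gt_eqF //; move: p1; lra.
  have nz : 1 - tt * sgn (c e) != 0 by rewrite gt_eqF // /sgn; case: ifP; lra.
  case: ifP => _; first by rewrite [(1 - _) * _]mulrCA divff // mulr1.
  by field.
by rewrite -big_mkcondr /=; apply: eq_bigl => e; rewrite andbC; case: (boolP (e \in N)) => //= /(subsetP NB) ->.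
Qed.

(** On a crossing pair the ratios multiply to [(1 - th) ^ 2 / (1 + tt) ^ 2], which [gE] turns into
    [4 * chi], and each factor [1 - x] equals two. On any other pair both sides vanish. The
    indicator of a crossing pair thus becomes a polynomial in the signs. *)
Lemma crossing_pair_ratio c N : #|N| = 2%N ->
  g * (crossing_pair c N)%:R * \prod_(e in N) ratio (c e) =
  chi * \prod_(e in N) (1 - x c e).
Proof.
move=> N2; have [t0 t1] := tt_bounds.
rewrite /crossing_pair N2 eqxx /=.
move/eqP/cards2P: N2 => [a [b [ab ->]]].
have prod2 : forall F : E -> R, \prod_(e in [set a; b]) F e = F a * F b.
  by move=> F; rewrite big_setU1 ?inE // big_set1.
rewrite !prod2; case: (boolP [forall e in _, _]) => [/forallP h|/forallPn /=[e]].
  have ca : c a = false by apply/negbTE; have := h a; rewrite !inE eqxx.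
  have cb : c b = false by apply/negbTE; have := h b; rewrite !inE eqxx orbT.
  rewrite ca cb /= /ratio /sgn.
  have nz : 1 + tt != 0 by rewrite gt_eqF //; lra.
  have -> : 1 - tt * -1 = 1 + tt by ring.
  have -> : (1 + th * -1) / (1 + tt) * ((1 + th * -1) / (1 + tt)) =
    (1 - th) ^+ 2 / (1 + tt) ^+ 2 by move: nz; move: (tt) => u nz; field.
  by rewrite mulr1 [g * (_ / _)]mulrA gE; move: nz; move: (tt) => u nz; field.
rewrite negb_imply negbK !inE => /andP[/orP[]/eqP-> ce]; rewrite ce /sgn mulr0n;
  ring.
Qed.

Lemma block_law_pair B c N : N \subset B -> #|N| = 2%N ->
  block_law g pr B c N = pair_ref B * (empty_ratio B c *
    (\prod_(e in N) ratio (c e) - chi * \prod_(e in N) (1 - x c e))).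
Proof.
move=> NB N2; rewrite block_lawE // block_pre_factor // N2 -/(pair_ref B).
rewrite (_ : N == set0 = false) ?mul0r ?addr0; last by rewrite -cards_eq0 N2.
rewrite -crossing_pair_ratio //; ring.
Qed.

Definition pair_sum B c : R :=
  \sum_(N : {set E} | (N \subset B) && (#|N| == 2)%N) \prod_(e in N) (1 - x c e).

Lemma block_law_empty B c :
  block_law g pr B c set0 =
  empty_ratio B c * ((1 - p) ^+ #|B| + chi * pair_ref B * pair_sum B c).
Proof.
rewrite block_lawE ?sub0set // block_pre_factor ?sub0set // eqxx mul1r.
rewrite {1}/crossing_pair !cards0 /= mulr0 subr0 mulr1 big_set0 mulr1 subn0 expr0 mul1r.
rewrite mulrDr; congr (_ + _); first by rewrite mulrC.
rewrite [X in g * X](bigID (fun N : {set E} => #|N| == 2)%N) /=.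
rewrite [X in _ + X]big1 ?addr0; last first.
  by move=> N /andP[_ /negbTE h]; rewrite /crossing_pair h mulr0.
rewrite /pair_sum !big_distrr /=; apply: eq_bigr => N /andP[NB /eqP N2].
rewrite block_pre_factor // N2 -/(pair_ref B).
rewrite (_ : _ * _ = empty_ratio B c * (pair_ref B * (g * (crossing_pair c N)%:R * \prod_(e in N) ratio (c e)))); last by ring.
rewrite crossing_pair_ratio //; ring.
Qed.

Definition block_moment B c c' : R :=
  \sum_(N : {set E} | N \subset B)
    block_law g pr B c N * block_law g pr B c' N / block_ref B N.

Lemma block_pre_moment B c c' :
  \sum_(N : {set E} | N \subset B) block_pre pr B c N * block_pre pr B c' N / P0 B N =
  \prod_(e in B) (1 + th ^+ 2 * p / (1 - p) * (x c e * x c' e)).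
Proof.
have q : 1 - p != 0 by rewrite gt_eqF //; move: p1; lra.
have p0' : p != 0 by rewrite gt_eqF.
transitivity (\sum_(N : {set E} | N \subset B) \prod_(e in B) (if e \in N then
     (p * (1 + th * x c e)) * (p * (1 + th * x c' e)) / p else
     (1 - p * (1 + th * x c e)) * (1 - p * (1 + th * x c' e)) / (1 - p))).
  apply: eq_bigr => N NB; rewrite -(prod_if_const _ _ NB) /block_pre.
  rewrite -big_split -prodf_div /=; apply: eq_bigr => e _; rewrite !prE.
  by case: ifP.
rewrite sum_subset_prod; apply: eq_bigr => e _.
by field; rewrite p0' q.
Qed.

(** A block with at most one edge contains no pair to delete. This covers single edges and empty
    blocks. *)
Lemma block_moment_small B c c' : (#|B| <= 1)%N ->
  block_moment B c c' = \prod_(e in B) (1 + th ^+ 2 * p / (1 - p) * (x c e * x c' e)).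
Proof.
move=> B1; rewrite -block_pre_moment; apply: eq_bigr => N NB.
have nb : npairs B = 0.
  rewrite /npairs; move: B1; case: #|B| => [|[|]] // _.
    by rewrite expr0n /= subrr mul0r.
  by rewrite expr1n subrr mul0r.
have ncp c1 (M : {set E}) : M \subset B -> crossing_pair c1 M = false.
  move=> /subset_leq_card h; rewrite /crossing_pair; apply/negbTE; rewrite negb_and.
  by apply/orP; left; rewrite neq_ltn (leq_ltn_trans (leq_trans h B1)).
have lawE c1 : block_law g pr B c1 N = block_pre pr B c1 N.
  rewrite block_lawE // ncp // mulr0 subr0 mulr1 big1 ?mulr0 ?addr0 // => M MB.
  by rewrite ncp // mulr0.
rewrite !lawE /block_ref nb mulr0 addr0.
have -> : (#|N| == 2)%N = false.
  by rewrite ltn_eqF // (leq_ltn_trans (leq_trans (subset_leq_card NB) B1)).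
by case: eqP => // ->; rewrite cards0 expr0 mul1r subn0.
Qed.

(** The first product is the second moment without adversary. On pairs, [(l - chi * V) (l' - chi *
    V') / (1 - chi)] replaces [l * l']; the last term is the change at the empty set. *)
Lemma block_moment_large B c c' : (2 <= #|B|)%N ->
  let V c N := \prod_(e in N) (1 - x c e) in
  let l c N := \prod_(e in N) ratio (c e) in
  let q := (1 - p) ^+ #|B| in
  block_moment B c c' =
  \prod_(e in B) (1 + th ^+ 2 * p / (1 - p) * (x c e * x c' e)) +
  empty_ratio B c * empty_ratio B c' * (chi * pair_ref B) *
  (\sum_(N : {set E} | (N \subset B) && (#|N| == 2)%N)
     ((l c N - V c N) * (l c' N - V c' N) / (1 - chi) - V c N * V c' N) +
   (pair_sum B c * pair_sum B c' -
    q / (q + chi * pair_ref B * npairs B) *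
      (pair_sum B c - npairs B) * (pair_sum B c' - npairs B)) / npairs B).
Proof.
move=> B2 V l q.
have np : 0 < npairs B.
  have : 2 <= #|B|%:R :> R by rewrite ler_nat.
  by rewrite /npairs; move: (#|B|%:R) => m hm; apply: divr_gt0 => //; nra.
have q0 : 0 < q by rewrite exprn_gt0 //; move: p1; lra.
have pr0 := pair_ref_gt0 B.
rewrite /block_moment (@sum_block_split B
  (fun N => block_pre pr B c N * block_pre pr B c' N / P0 B N)); last first.
  move=> N NB N2 N0; rewrite !block_lawE // /block_ref /crossing_pair.
  by rewrite (negbTE N2) (negbTE N0) /= !mulr0 !subr0 !mulr1 !mul0r !addr0.
rewrite block_pre_moment mulrDr; congr (_ + (_ + _)).
  rewrite big_distrr /=; apply: eq_bigr => N /andP[NB /eqP N2].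
  rewrite !block_law_pair // !block_pre_factor // N2 -/(pair_ref B) /block_ref N2 eqxx.
  have c1 : 1 - chi != 0 by rewrite gt_eqF //; move: chi1; lra.
  have pr0' : pair_ref B != 0 by rewrite gt_eqF.
  rewrite -/(l c N) -/(l c' N) -/(V c N) -/(V c' N).
  by field; rewrite c1 pr0'.
rewrite !block_law_empty !block_pre_factor ?sub0set // /block_ref !cards0 eqxx /=.
rewrite subn0 expr0 !mul1r !big_set0 !mulr1 -/q.
have cp : 0 <= chi * pair_ref B * npairs B by rewrite mulr_ge0 ?(ltW np) // mulr_ge0 // ltW.
have n1 : q + chi * pair_ref B * npairs B != 0 by rewrite gt_eqF // ltr_pwDl.
have n2 : npairs B != 0 by rewrite gt_eqF.
have n3 : q != 0 by rewrite gt_eqF.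
by field; rewrite n1 n2 n3.
Qed.

(** * Approximation of the block moments for typical spins *)

(** By Newton's identity only the first power sum matters, since the diagonal is of order [#|B|] and
    is absorbed through [1 <= z * #|B|]. The constant is [207 = 7 * 18 + 81]: the difference of
    squares plus the diagonal. *)
Lemma sum_card2_approx B (f : E -> R) (f0 z : R) : 0 < z ->
  1 <= z * #|B|%:R -> (forall e, `|f e| <= 9) -> `|f0| <= 9 ->
  `|\sum_(e in B) f e - #|B|%:R * f0| <= 7 * z * #|B|%:R ->
  `|\sum_(N : {set E} | (N \subset B) && (#|N| == 2)%N) \prod_(e in N) f e
    - #|B|%:R ^+ 2 / 2 * f0 ^+ 2| <= #|B|%:R ^+ 2 / 2 * (207 * z).
Proof.
move=> z0 zm f9 f09; rewrite sum_card2_prod.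
have SS : `|\sum_(e in B) f e| <= 9 * #|B|%:R.
  apply: le_trans (ler_norm_sum _ _ _) _.
  by rewrite mulr_natr -sumr_const; apply: ler_sum => e _.
have QQ : 0 <= \sum_(e in B) f e ^+ 2 <= 81 * #|B|%:R.
  rewrite sumr_ge0 /=; last by move=> e _; exact: sqr_ge0.
  rewrite mulr_natr -sumr_const; apply: ler_sum => e _.
  by have := f9 e; rewrite ler_norml => /andP[]; nra.
move: SS QQ; move: (\sum_(e in B) f e) (\sum_(e in B) f e ^+ 2) => S Q SS /andP[Q0 Q1].
have m0 : 0 <= #|B|%:R :> R by [].
move: zm SS Q1 m0; move: (#|B|%:R) => m zm SS Q1 m0 h.
have h2 : `|S ^+ 2 - (m * f0) ^+ 2| <= 7 * z * m * (18 * m).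
  rewrite subr_sqr normrM ler_pM //.
  apply: le_trans (ler_normD _ _) _; rewrite normrM (ger0_norm m0); nra.
have h3 : 81 * m <= 81 * (z * m) * m by nra.
move: h2; rewrite !ler_norml => /andP[h2 h4].
apply/andP; split; lra.
Qed.

Lemma ratio_approx b (z : R) : 4 * tt <= z -> z <= 1 / 2 ->
  `|ratio b - (1 + th * sgn b)| <= z /\ `|ratio b| <= 3.
Proof.
have [t0 t1] := tt_bounds => h1 h2.
have : `|ratio b - (1 + th * sgn b)| <= z.
  rewrite /ratio; move: t0 t1 h1 h2; move: (tt) => t t0 t1 h1 h2.
  have -> : (1 + th * sgn b) / (1 - t * sgn b) - (1 + th * sgn b) =
    (1 + th * sgn b) * (t * sgn b) / (1 - t * sgn b).
    by field; rewrite gt_eqF // /sgn; case: ifP; lra.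
  have d0 : 0 < 1 - t * sgn b by rewrite /sgn; case: ifP; lra.
  rewrite normrM normfV (gtr0_norm d0) ler_pdivrMr // normrM.
  have : `|t * sgn b| <= t by rewrite /sgn; case: ifP => _; rewrite ler_norml; lra.
  have : `|1 + th * sgn b| <= 2.
    by rewrite /sgn; case: ifP => _; rewrite ler_norml; move: th0 th1; lra.
  have : 1 / 2 <= 1 - t * sgn b by rewrite /sgn; case: ifP; lra.
  move: (`|t * _|) (`|1 + _|) (normr_ge0 (t * sgn b)) (normr_ge0 (1 + th * sgn b)) => u v; nra.
move=> h; split=> //.
have : `|1 + th * sgn b| <= 2.
  by rewrite /sgn; case: ifP => _; rewrite ler_norml; move: th0 th1; lra.
move: h; rewrite !ler_norml => /andP[? ?] /andP[? ?]; apply/andP; split; lra.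
Qed.

(** The upper bound exponentiates the small sum of signs. For the lower one, the product with [tt]
    replaced by its opposite has the same upper bound, and both products together give
    [(1 - tt ^ 2) ^ #|B|], to which Bernoulli's inequality applies. *)
Lemma empty_ratio_bounds B c (z kk : R) : 1 <= kk -> tt * #|B|%:R <= 2 * kk ->
  #|B|%:R * tt ^+ 2 <= z -> 0 < z -> z <= 1 / 2 -> 2 * kk * z <= 1 ->
  `|\sum_(e in B) x c e| <= z * #|B|%:R ->
  (1 - z) * (1 - 2 * kk * z) <= empty_ratio B c <= expR (2 * kk * z).
Proof.
move=> k1 tm t2 z0 z1 kz; rewrite ler_norml => /andP[X1 X2].
have [t0 t1] := tt_bounds; move: t0 t1 tm t2; rewrite /empty_ratio.
move: (tt) => t t0 t1 tm t2.
have sg1 b : -1 <= sgn b <= 1 by rewrite /sgn; case: b; lra.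
have tX : t * (z * #|B|%:R) <= 2 * kk * z by nra.
have up (u : R) : `|u| = t -> \prod_(e in B) (1 + u * x c e) <= expR (2 * kk * z).
  move=> hu; apply: (@le_trans _ _ (\prod_(e in B) expR (u * x c e))).
    apply: ler_prod => e _; rewrite expR_ge1Dx andbT.
    have := sg1 (c e); have : u <= t by rewrite -hu ler_norm.
    have : - t <= u by rewrite -hu lerNl -normrN ler_norm.
    by nra.
  rewrite -expR_sum -big_distrr ler_expR /=; apply: le_trans tX.
  move: X1 X2; move: (\sum_(e in B) _) => X X1 X2.
  have : u * X <= `|u| * `|X| by rewrite -normrM ler_norm.
  by rewrite hu => h; apply: (le_trans h); rewrite ler_pM2l // ler_norml X1.
apply/andP; split; last first.
  have := up (- t); rewrite normrN gtr0_norm // => /(_ erefl).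
  by under eq_bigr => e _ do rewrite mulNr.
have := up t; rewrite gtr0_norm // => /(_ erefl) hF.
have er : \prod_(e in B) (1 - t * x c e) * \prod_(e in B) (1 + t * x c e) = (1 - t ^+ 2) ^+ #|B|.
  rewrite -big_split /= -prodr_const; apply: eq_bigr => e _.
  by rewrite /sgn; case: ifP => _; ring.
have bern m : 1 - m%:R * t ^+ 2 <= (1 - t ^+ 2) ^+ m.
  elim: m => [|m IH]; first by rewrite mul0r subr0 expr0.
  rewrite -natr1; have m0 : 0 <= m%:R :> R by [].
  have : (1 - t ^+ 2) * (1 - m%:R * t ^+ 2) <= (1 - t ^+ 2) * (1 - t ^+ 2) ^+ m.
    by apply: ler_wpM2l => //; nra.
  have : 0 <= m%:R * (t ^+ 2) ^+ 2 by rewrite mulr_ge0 ?sqr_ge0.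
  by rewrite [_ ^+ m.+1]exprS; move: (t ^+ 2) ((1 - _) ^+ m) => u v; lra.
have F0 : 0 < \prod_(e in B) (1 + t * x c e).
  by apply: prodr_gt0 => e _; have := sg1 (c e); nra.
have G0 : 0 < \prod_(e in B) (1 - t * x c e).
  by apply: prodr_gt0 => e _; have := sg1 (c e); nra.
have : 1 - z <= \prod_(e in B) (1 - t * x c e) * expR (2 * kk * z).
  apply: le_trans (_ : (1 - t ^+ 2) ^+ #|B| <= _).
    by apply: le_trans (bern _); lra.
  by rewrite -er ler_pM2l.
have := expR_mul_le1 (2 * kk * z); have := expR_gt0 (2 * kk * z).
move: G0; move: (expR _) (\prod_(e in B) (1 - t * x c e)) => F G G0 F1 h1 h2.
have : (1 - z) * (1 - 2 * kk * z) <= G * F * (1 - 2 * kk * z) by apply: ler_wpM2r => //; lra.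
by nra.
Qed.

(** The uniform bound [3] lets a product of two such functions satisfy the bound [9] of
    [sum_card2_approx]. *)
Definition near_affine (z : R) (F : bool -> R) (u : R) :=
  `|u| <= 1 /\ forall b, `|F b - (1 + u * sgn b)| <= z /\ `|F b| <= 3.

Lemma norm_sgn b : `|sgn b| = 1.
Proof. by rewrite /sgn; case: b; rewrite ?normrN normr1. Qed.

Lemma affine_le2 u b : `|u| <= 1 -> `|1 + u * sgn b| <= 2.
Proof.
move=> u1; apply: le_trans (ler_normD _ _) _.
by rewrite normrM norm_sgn mulr1 normr1; lra.
Qed.

Lemma norm_mulB_le (a a0 b b0 z : R) : `|a - a0| <= z -> `|b - b0| <= z ->
  `|b| <= 3 -> `|a0| <= 2 -> `|a * b - a0 * b0| <= 5 * z.
Proof.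
move=> h1 h2 h3 h4.
have -> : a * b - a0 * b0 = (a - a0) * b + a0 * (b - b0) by ring.
apply: le_trans (ler_normD _ _) _; rewrite !normrM.
have -> : 5 * z = z * 3 + 2 * z by ring.
by apply: lerD; apply: ler_pM.
Qed.

(** The sum of [(1 + u * x) (1 + v * x')] is [(1 + u * v * y) * #|B|] plus two magnetization terms,
    each at most [z * #|B|] for typical spins. With [5 * z] for the affine approximation this makes
    the error [7 * z]. *)
Lemma pair_moment_approx B c c' (F F' : bool -> R) (u v y z : R) :
  0 < z -> 1 <= z * #|B|%:R -> `|y| <= 1 ->
  near_affine z F u -> near_affine z F' v ->
  `|\sum_(e in B) x c e| <= z * #|B|%:R -> `|\sum_(e in B) x c' e| <= z * #|B|%:R ->
  \sum_(e in B) x c e * x c' e = y * #|B|%:R ->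
  `|\sum_(N : {set E} | (N \subset B) && (#|N| == 2)%N)
      (\prod_(e in N) F (c e) * \prod_(e in N) F' (c' e))
    - #|B|%:R ^+ 2 / 2 * (1 + u * v * y) ^+ 2| <= #|B|%:R ^+ 2 / 2 * (207 * z).
Proof.
move=> z0 zm y1 [u1 hF] [v1 hF'] X Y yE.
under eq_bigr => N _ do rewrite -big_split /=.
apply: sum_card2_approx => //.
- move=> e; rewrite normrM (_ : 9 = 3 * 3); last by ring.
  by apply: ler_pM => //; [exact: (proj2 (hF _))|exact: (proj2 (hF' _))].
- apply: le_trans (ler_normD _ _) _; rewrite !normrM normr1.
  have := normr_ge0 u; have := normr_ge0 v; have := normr_ge0 y.
  have : `|u| * `|v| <= 1 * 1 by exact: ler_pM.
  by move: (`|u|) (`|v|) (`|y|) y1 => a b d; nra.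
have sumE : \sum_(e in B) (1 + u * x c e) * (1 + v * x c' e) =
    #|B|%:R + u * (\sum_(e in B) x c e) + v * (\sum_(e in B) x c' e) + u * v * (y * #|B|%:R).
  rewrite -yE -sumr_const !big_distrr /= -!big_split /=; apply: eq_bigr => e _; ring.
have : `|\sum_(e in B) F (c e) * F' (c' e) - \sum_(e in B) (1 + u * x c e) * (1 + v * x c' e)|
    <= 5 * z * #|B|%:R.
  rewrite -sumrB; apply: le_trans (ler_norm_sum _ _ _) _.
  rewrite mulr_natr -sumr_const; apply: ler_sum => e _.
  by apply: norm_mulB_le; rewrite ?affine_le2 ?(proj1 (hF _)) ?(proj1 (hF' _)) ?(proj2 (hF' _)).
rewrite sumE.
have hu : `|u * (\sum_(e in B) x c e)| <= z * #|B|%:R by rewrite normrM -[leRHS]mul1r ler_pM.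
have hv : `|v * (\sum_(e in B) x c' e)| <= z * #|B|%:R by rewrite normrM -[leRHS]mul1r ler_pM.
have -> : #|B|%:R * (1 + u * v * y) = #|B|%:R + u * v * (y * #|B|%:R) by ring.
move: hu hv; move: (\sum_(e in B) _ * _) (u * \sum_(e in B) _) (v * \sum_(e in B) _) (u * v * _) => S U V W.
by rewrite !ler_norml => /andP[? ?] /andP[? ?] /andP[? ?]; apply/andP; split; lra.
Qed.

(** The error and the smallness condition of [modified_term_le] at [eta = 207 * z], the precision of
    [sum_card2_approx]. *)
Definition block_error (kk z : R) : R := 45 * kk ^+ 3 * (207 * z).
Definition small_deviation (kk z : R) : bool := 4 * kk * (207 * z) <= 1.

Lemma block_error_ge0 kk z : 0 <= kk -> 0 <= z -> 0 <= block_error kk z.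
Proof.
by move=> k0 z0; apply: mulr_ge0; apply: mulr_ge0; rewrite ?ler0n ?exprn_ge0.
Qed.

(** To leading order, the mass that the reference law moves from the pairs to the empty set. *)
Definition weight B : R := chi * pair_ref B * (#|B|%:R ^+ 2 / 2).

Lemma weight_bounds B (kk : R) : 1 <= kk -> p * #|B|%:R <= kk -> 0 <= weight B <= kk ^+ 2.
Proof.
move=> k1 pm; have q0 := p0; have q1 := p1; have c0 := chi0; have c1 := chi1.
have pm0 : 0 <= p * #|B|%:R by rewrite mulr_ge0 // ltW.
have pr1 : pair_ref B * #|B|%:R ^+ 2 <= kk ^+ 2.
  rewrite /pair_ref mulrAC -exprMn -[leRHS]mulr1; apply: ler_pM.
  - exact: sqr_ge0.
  - by rewrite exprn_ge0 //; lra.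
  - by apply: lerXn2r; rewrite ?nnegrE //; lra.
  - by rewrite exprn_ile1 //; lra.
have pr2 : 0 <= pair_ref B * #|B|%:R ^+ 2.
  by rewrite mulr_ge0 ?sqr_ge0 // ltW // pair_ref_gt0.
rewrite /weight (_ : chi * _ * _ = chi / 2 * (pair_ref B * #|B|%:R ^+ 2)); last by ring.
move: pr1 pr2; move: (pair_ref B * _) => u u1 u0.
have : 0 <= (1 - chi / 2) * u by rewrite mulr_ge0 //; lra.
have : 0 <= chi / 2 * u by rewrite mulr_ge0 //; lra.
by lra.
Qed.

Lemma near_affine_one z : 0 < z -> near_affine z (fun=> 1) 0.
Proof.
move=> z0; split; first by rewrite normr0.
by move=> b; rewrite mul0r addr0 subrr normr0 normr1; split; lra.
Qed.

Lemma near_affine_opp z : 0 < z -> near_affine z (fun b => 1 - sgn b) (-1).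
Proof.
move=> z0; split; first by rewrite normrN normr1.
move=> b; rewrite mulN1r subrr normr0 ltW //; split=> //.
by apply: le_trans (ler_normB _ _) _; rewrite norm_sgn normr1; lra.
Qed.

Lemma npairs_bounds B (z eta : R) : 0 < #|B|%:R :> R -> 1 <= z * #|B|%:R -> z <= eta ->
  #|B|%:R ^+ 2 / 2 * (1 - eta) <= npairs B <= #|B|%:R ^+ 2 / 2 .
Proof.
rewrite /npairs; move: (#|B|%:R) => m m0 zm ze; apply/andP; split; last by lra.
have : m <= z * m * m by rewrite -[leLHS]mul1r ler_wpM2r // ltW.
have : z * (m * m) <= eta * (m * m) by rewrite ler_wpM2r // mulr_ge0 // ltW.
by rewrite expr2; lra.
Qed.

Lemma empty_weight_bounds B :
  0 <= (1 - p) ^+ #|B| / ((1 - p) ^+ #|B| + chi * pair_ref B * npairs B) <= 1.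
Proof.
have qB : 0 < (1 - p) ^+ #|B| by rewrite exprn_gt0 //; move: p1; lra.
have cpn : 0 <= chi * pair_ref B * npairs B.
  by rewrite mulr_ge0 ?npairs_ge0 // mulr_ge0 // ltW // pair_ref_gt0.
have dd : 0 < (1 - p) ^+ #|B| + chi * pair_ref B * npairs B by rewrite ltr_pwDl.
by rewrite divr_ge0 ?(ltW dd) ?(ltW qB) //= ler_pdivrMr // mul1r lerDl.
Qed.

Lemma unmodified_le B c c' : \prod_(e in B) (1 + th ^+ 2 * p / (1 - p) * (x c e * x c' e)) <=
  expR (th ^+ 2 * p / (1 - p) * \sum_(e in B) x c e * x c' e).
Proof.
have h0 := th0; have h1 := th1; have q0 := p0; have q1 := p1.
rewrite big_distrr /= expR_sum; apply: ler_prod => e _; rewrite expR_ge1Dx andbT.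
have l1 : th ^+ 2 * p / (1 - p) <= 1.
  have t2 : th ^+ 2 <= 1 by rewrite expr_le1 //; lra.
  rewrite ler_pdivrMr ?mul1r; last by lra.
  by apply: le_trans (_ : 1 * p <= _); [apply: ler_wpM2r => //; exact: ltW|lra].
have l0 : 0 <= th ^+ 2 * p / (1 - p).
  by apply: divr_ge0; [apply: mulr_ge0; [exact: sqr_ge0|lra]|lra].
have : `|x c e * x c' e| <= 1 by rewrite normrM !norm_sgn mulr1.
rewrite ler_norml => /andP[]; move: (_ / _) l0 l1 (x c e * _) => l l0 l1 y y1 y2; nra.
Qed.

(** For typical spins the pair moments depend on the two labellings only through the mean overlap
    [y]. Then [bracket_le] evaluates the correction in [block_moment_large], and its prefactor,
    close to one, goes into [block_error]. *)
Lemma block_moment_le B c c' (z kk : R) : (2 <= #|B|)%N ->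
  1 <= kk -> 0 < z -> small_deviation kk z -> 1 <= z * #|B|%:R -> 4 * tt <= z ->
  tt * #|B|%:R <= 2 * kk -> #|B|%:R * tt ^+ 2 <= z -> p * #|B|%:R <= kk ->
  `|\sum_(e in B) x c e| <= z * #|B|%:R -> `|\sum_(e in B) x c' e| <= z * #|B|%:R ->
  forall y, \sum_(e in B) x c e * x c' e = y * #|B|%:R ->
  block_moment B c c' <= expR (th ^+ 2 * p / (1 - p) * (y * #|B|%:R)) +
    weight B * (gain1 th chi * y - gain2 th chi * y ^+ 2) + block_error kk z.
Proof.
move=> B2 k1 z0 kz zm tz tm t2 pm X Y y yE.
have m0 : 0 < #|B|%:R :> R by rewrite ltr0n (leq_trans _ B2).
rewrite /small_deviation in kz.
have ze : z <= 207 * z by rewrite ler_peMl ?(ltW z0) // (ler_nat R 1 207).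
have e0 : 0 < 207 * z by exact: lt_le_trans ze.
have kz4 : 4 * (207 * z) <= 4 * kk * (207 * z).
  by rewrite -[leRHS]mulrA ler_pM2l // ler_peMl // ltW.
have z207 : 4 * (207 * z) <= 1 by exact: le_trans kz.
have z2 : z <= 1 / 2 by lra.
have kz1 : 2 * kk * z <= 1.
  apply: le_trans kz; apply: ler_pM => //; rewrite ?(ltW z0) ?mulr_ge0 //; lra.
have y1 : `|y| <= 1.
  have : `|y * #|B|%:R| <= #|B|%:R.
    rewrite -yE; apply: le_trans (ler_norm_sum _ _ _) _.
    by rewrite -sumr_const; apply: ler_sum => e _; rewrite normrM !norm_sgn mulr1.
  by rewrite normrM (gtr0_norm m0) -{2}[#|B|%:R]mul1r ler_pM2r.
have [h0 h1] : 0 < th /\ th < 1 by [].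
have [c0 c1] : 0 <= chi /\ chi <= 1 / 2 by [].
rewrite block_moment_large //= -addrA; apply: lerD.
  by rewrite -yE unmodified_le.
have ra : near_affine z ratio th.
  by split; [rewrite ger0_norm ltW|move=> b; exact: ratio_approx].
have va := near_affine_opp z0.
have mu0 : 0 < #|B|%:R ^+ 2 / 2 :> R by rewrite divr_gt0 ?exprn_gt0.
pose V c N := \prod_(e in N) (1 - x c e).
pose l c N := \prod_(e in N) ratio (c e).
pose e2 (f : {set E} -> R) := \sum_(N : {set E} | (N \subset B) && (#|N| == 2)%N) f N.
have -> : \sum_(N : {set E} | (N \subset B) && (#|N| == 2)%N)
     ((\prod_(e in N) ratio (c e) - \prod_(e in N) (1 - x c e)) *
      (\prod_(e in N) ratio (c' e) - \prod_(e in N) (1 - x c' e)) / (1 - chi) -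
      \prod_(e in N) (1 - x c e) * \prod_(e in N) (1 - x c' e)) =
  (e2 (fun N => l c N * l c' N) - e2 (fun N => l c N * V c' N)
   - e2 (fun N => V c N * l c' N) + e2 (fun N => V c N * V c' N)) / (1 - chi)
   - e2 (fun N => V c N * V c' N).
  rewrite /e2 -!sumrB -big_split /= big_distrl /= -sumrB; apply: eq_bigr => N _.
  by rewrite /l /V; ring.
have one_a := near_affine_one z0.
have Tb : `|pair_sum B c - #|B|%:R ^+ 2 / 2| <= #|B|%:R ^+ 2 / 2 * (207 * z).
  have := pair_moment_approx z0 zm y1 va one_a X Y yE.
  rewrite mulr0 mul0r addr0 expr1n mulr1 => h.
  by apply: le_trans h; rewrite /pair_sum; under [in leRHS]eq_bigr => N _ do rewrite big1_eq mulr1.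
have Tb' : `|pair_sum B c' - #|B|%:R ^+ 2 / 2| <= #|B|%:R ^+ 2 / 2 * (207 * z).
  have := pair_moment_approx z0 zm y1 one_a va X Y yE.
  rewrite mul0r mul0r addr0 expr1n mulr1 => h.
  by apply: le_trans h; rewrite /pair_sum; under [in leRHS]eq_bigr => N _ do rewrite big1_eq mul1r.
have pr0 := pair_ref_gt0 B.
have w01 := empty_weight_bounds B.
have nb := npairs_bounds m0 zm ze.
have br := bracket_le c0 c1 mu0 e0 z207 (pair_moment_approx z0 zm y1 ra ra X Y yE)
  (pair_moment_approx z0 zm y1 ra va X Y yE) (pair_moment_approx z0 zm y1 va ra X Y yE)
  (pair_moment_approx z0 zm y1 va va X Y yE) Tb Tb' w01 nb.

have [F0 F1] := mul_empty_ratio_close k1 z0 kz (empty_ratio_bounds k1 tm t2 z0 z2 kz1 X)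
  (empty_ratio_bounds k1 tm t2 z0 z2 kz1 Y).
have [/andP[g0 g1] g2] := gain_bounds h0 h1 c0 c1.
have G20 : `|gain1 th chi * y - gain2 th chi * y ^+ 2| <= 20.
  apply: le_trans (ler_normB _ _) _; rewrite (normrM (gain1 _ _)) (normrM (gain2 _ _)).
  rewrite (_ : 20 = 14 * 1 + 6 * (1 * 1)); last by ring.
  have y2 : `|y ^+ 2| <= 1 * 1 by rewrite normrX expr2 ler_pM.
  apply: lerD; last exact: ler_pM.
  by apply: ler_pM => //; rewrite ger0_norm.
have W0 := weight_bounds k1 pm.
apply: le_trans (modified_term_le k1 e0 kz F0 F1 G20 W0).
rewrite (_ : weight B * _ = empty_ratio B c * empty_ratio B c' * (chi * pair_ref B) *
  (#|B|%:R ^+ 2 / 2 * (gain1 th chi * y - gain2 th chi * y ^+ 2 + 20 * (207 * z)))); last first.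
  by rewrite /weight; ring.
apply: ler_wpM2l; last exact: br.
by rewrite mulr_ge0 // mulr_ge0 // ltW.
Qed.

End ModelConstants.
End Block.

(** * Sums over spin configurations and moments of magnetizations *)

Section Spins.
Variables (R : realType) (n : nat).
Implicit Types (s t r : spins n) (U W A : {set 'I_n}) (v : 'I_n).

Definition spin s v : R := sgn R (s v).
Definition mag A s : R := \sum_(v in A) spin s v.
Definition overlap s t : spins n := [ffun v => s v == t v].

Lemma spin_overlap s t v : spin (overlap s t) v = spin s v * spin t v.
Proof. by rewrite /spin ffunE /sgn; case: (s v); case: (t v) => /=; ring. Qed.

Lemma norm_mag_le A s : `|mag A s| <= #|A|%:R.
Proof.
apply: le_trans (ler_norm_sum _ _ _) _; rewrite -sumr_const.
by apply: ler_sum => v _; rewrite /spin norm_sgn.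
Qed.

Lemma sum_spins_prod (F : 'I_n -> bool -> R) :
  \sum_(s : spins n) \prod_v F v (s v) = \prod_v (F v true + F v false).
Proof.
rewrite -(bigA_distr_bigA F); apply: eq_bigr => v _.
by rewrite big_bool.
Qed.

Lemma card_spins : \sum_(s : spins n) (1 : R) = 2 ^+ n.
Proof. by rewrite sumr_const card_ffun card_bool card_ord natrX. Qed.

(** For fixed [s] the map [overlap s] is an involution, so the overlap of two uniform configurations
    is uniform. *)
Lemma sum_overlap (F : spins n -> R) :
  \sum_(s : spins n) \sum_(t : spins n) F (overlap s t) = 2 ^+ n * \sum_(r : spins n) F r.
Proof.
rewrite -card_spins mulr_suml; apply: eq_bigr => s _; rewrite mul1r.
rewrite [RHS](reindex_onto (overlap s) (overlap s)) /=.
  apply: eq_bigl => t; apply/esym/eqP/ffunP => v; rewrite !ffunE.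
  by case: (s v); case: (t v).
by move=> t _; apply/ffunP => v; rewrite !ffunE; case: (s v); case: (t v).
Qed.

Definition merge W r r' : spins n := [ffun v => if v \in W then r' v else r v].

(** Exchanging two configurations on [W] is an involution on pairs. The spins in [W] can then be
    averaged while the others are frozen. *)
Lemma sum_merge W (F : spins n -> R) :
  2 ^+ n * \sum_(r : spins n) F r =
  \sum_(r : spins n) \sum_(r' : spins n) F (merge W r r').
Proof.
rewrite -card_spins mulr_sumr.
transitivity (\sum_(r : spins n) \sum_(r' : spins n) F r).
  by apply: eq_bigr => r _; rewrite mulr_suml; apply: eq_bigr => r' _; rewrite mul1r.
rewrite !pair_bigA /=.
rewrite [RHS](reindex_onto (fun q => (merge W q.1 q.2, merge W q.2 q.1))
  (fun q => (merge W q.1 q.2, merge W q.2 q.1))) /=.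
  apply: eq_big => [[r r']|[r r'] _] /=.
    apply/esym/eqP; congr (_, _); apply/ffunP => v; rewrite !ffunE; by case: (v \in W).
  by congr F; apply/ffunP => v; rewrite !ffunE; case: (v \in W).
by case=> r r' _ /=; congr (_, _); apply/ffunP => v; rewrite !ffunE; case: (v \in W).
Qed.

Lemma mag_merge_in W r r' : mag W (merge W r r') = mag W r'.
Proof. by apply: eq_bigr => v vW; rewrite /spin ffunE vW. Qed.

Lemma mag_merge_out W r r' : mag (~: W) (merge W r r') = mag (~: W) r.
Proof.
by apply: eq_bigr => v; rewrite inE => /negbTE vW; rewrite /spin ffunE vW.
Qed.

Definition flip1 v s : spins n := [ffun u => if u == v then ~~ s u else s u].

Lemma flip1K v : involutive (flip1 v).
Proof. by move=> s; apply/ffunP => u; rewrite !ffunE; case: eqP => //; rewrite negbK. Qed.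

Lemma sum_flip1 v (F : spins n -> R) :
  \sum_(s : spins n) F s = 2^-1 * \sum_(s : spins n) (F s + F (flip1 v s)).
Proof.
have -> : \sum_(s : spins n) (F s + F (flip1 v s)) = \sum_(s : spins n) F s + \sum_(s : spins n) F s.
  by rewrite big_split /=; congr (_ + _); rewrite [RHS](reindex_inj (inv_inj (flip1K v))).
by field.
Qed.

Lemma mag_setU1 A v s : v \notin A -> mag (v |: A) s = spin s v + mag A s.
Proof. by move=> vA; rewrite /mag big_setU1. Qed.

Lemma mag_setU1_flip1 A v s : v \notin A -> mag (v |: A) (flip1 v s) = - spin s v + mag A s.
Proof.
move=> vA; rewrite mag_setU1 //; congr (_ + _).
  by rewrite /spin ffunE eqxx /sgn; case: (s v) => /=; ring.
apply: eq_bigr => u uA; rewrite /spin ffunE; case: eqP => // uv.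
by rewrite uv (negbTE vA) in uA.
Qed.

(* Averaging over one spin turns [b] into [b - 1]. *)
Lemma expR_sqr_step (m b : R) : 1 < b ->
  (expR ((1 + m) ^+ 2 / (2 * b)) + expR ((- 1 + m) ^+ 2 / (2 * b))) / 2 <=
  expR (1 / (2 * b)) * expR (m ^+ 2 / (2 * (b - 1))).
Proof.
move=> b1; have b0 : b != 0 by rewrite gt_eqF //; lra.
have b10 : b - 1 != 0 by rewrite gt_eqF //; lra.
have -> : (1 + m) ^+ 2 / (2 * b) = (m ^+ 2 + 1) / (2 * b) + m / b by field.
have -> : (- 1 + m) ^+ 2 / (2 * b) = (m ^+ 2 + 1) / (2 * b) + - (m / b) by field.
rewrite !expRD -mulrDr -mulrA -/(coshR (m / b)).
apply: le_trans (ler_wpM2l (expR_ge0 _) (coshR_le_expR _)) _.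
rewrite -!expRD ler_expR -subr_ge0.
have -> : 1 / (2 * b) + m ^+ 2 / (2 * (b - 1)) - ((m ^+ 2 + 1) / (2 * b) + (m / b) ^+ 2 / 2) =
  m ^+ 2 / (2 * b ^+ 2 * (b - 1)).
  by field; rewrite b0 b10.
apply: divr_ge0; first exact: sqr_ge0.
by apply: mulr_ge0; [rewrite mulr_ge0 ?sqr_ge0|lra].
Qed.

(** Remove one spin at a time: [expR_sqr_step] lowers [b] and the cardinality together, so their
    difference is preserved, and each step costs [1 / (2 * b)] in the exponent for the current,
    larger [b]. *)
Lemma exp_moment_mag A (b : R) : #|A|%:R < b ->
  \sum_(s : spins n) expR (mag A s ^+ 2 / (2 * b)) <=
  2 ^+ n * expR (#|A|%:R / (2 * (b - #|A|%:R))).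
Proof.
elim: {A}#|A| {-2}A (erefl #|A|) b => [|m IH] A mE b hb.
  move/eqP: mE; rewrite cards_eq0 => /eqP ->.
  under eq_bigr => s _ do rewrite /mag big_set0 expr0n /= mul0r expR0.
  by rewrite card_spins cards0 mul0r expR0 mulr1.
have [v vA] : exists v, v \in A by apply/set0Pn; rewrite -cards_eq0 mE.
have AE : A = v |: (A :\ v) by rewrite setD1K.
have vA' : v \notin A :\ v by rewrite !inE eqxx.
have mE' : #|A :\ v| = m by move: mE; rewrite AE cardsU1 vA' => -[] <-; rewrite -AE.
have m0 : 0 <= m%:R :> R by [].
rewrite mE -natr1 in hb *.
rewrite (sum_flip1 v) mulr_sumr.
apply: (@le_trans _ _ (\sum_(s : spins n) expR (1 / (2 * b)) *
   expR (mag (A :\ v) s ^+ 2 / (2 * (b - 1))))).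
  have magE s : mag A s = spin s v + mag (A :\ v) s by rewrite {1}AE mag_setU1.
  have magE' s : mag A (flip1 v s) = - spin s v + mag (A :\ v) s.
    by rewrite {1}AE mag_setU1_flip1.
  apply: ler_sum => s _; rewrite magE magE'.
  rewrite mulrC; apply: le_trans (expR_sqr_step _ _); last by lra.
  by rewrite /spin /sgn; case: (s v); rewrite ?opprK // [X in X / 2 <= _]addrC.
rewrite -mulr_sumr; apply: le_trans (ler_wpM2l (expR_ge0 _) (IH _ mE' (b - 1) _)) _.
  by rewrite mE'; lra.
rewrite mE' mulrCA ler_pM2l ?exprn_gt0 // -expRD ler_expR.
have d0 : 0 < b - m%:R - 1 by lra.
have b0 : 0 < b by lra.
rewrite -subr_ge0.
have -> : (m%:R + 1) / (2 * (b - (m%:R + 1))) - (1 / (2 * b) + m%:R / (2 * (b - 1 - m%:R))) =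
  (m%:R + 1) / (2 * b * (b - m%:R - 1)).
  by field; rewrite !gt_eqF //; lra.
by apply: divr_ge0; [|apply: mulr_ge0]; lra.
Qed.

Lemma sum_spin2 u v : u != v -> \sum_(s : spins n) spin s u * spin s v = 0.
Proof.
move=> uv; rewrite (sum_flip1 u) big1 ?mulr0 // => s _.
by rewrite /spin !ffunE eqxx eq_sym (negbTE uv) /sgn; case: (s u) => /=; ring.
Qed.

Lemma sum_mag_sqr A : \sum_(s : spins n) mag A s ^+ 2 = 2 ^+ n * #|A|%:R.
Proof.
under eq_bigr => s _ do rewrite /mag expr2 mulr_suml.
rewrite exchange_big /= -sumr_const mulr_sumr; apply: eq_bigr => v vA.
under eq_bigr => s _ do rewrite mulr_sumr.
rewrite exchange_big /= (bigD1 v) //= [X in _ + X]big1 ?addr0; last first.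
  by move=> u /andP[_ uv]; rewrite sum_spin2 // eq_sym.
rewrite mulr1 -card_spins; apply: eq_bigr => s _.
by rewrite /spin /sgn; case: (s v); ring.
Qed.

End Spins.

(** * Partition of the vertex pairs into stars and single edges *)

Section Model.
Variables (R : realType) (n : nat) (W : {set 'I_n}).
Implicit Types (s t : spins n) (e : vpair n) (G : graph n) (v : 'I_n).

(** Labels that no pair receives give empty blocks, whose second moment is one; products may
    therefore run over the whole sum type. *)
Definition star_label e : vpair n + 'I_n :=
  if [pick v | val e :&: W == [set v]] is Some v then inr v else inl e.

Definition blk i : {set vpair n} := [set e | star_label e == i].

Lemma blk_inr v : blk (inr v) = [set e | val e :&: W == [set v]].
Proof.
apply/setP => e; rewrite !inE /star_label; case: pickP => [u /eqP ->|h].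
  by apply/eqP/eqP => [[->]//|/set1_inj ->].
by rewrite h; apply/eqP.
Qed.

Lemma blk_inr_out v : v \notin W -> blk (inr v) = set0.
Proof.
move=> vW; rewrite blk_inr; apply/setP => e; rewrite !inE; apply/negP => /eqP/setP/(_ v).
by rewrite !inE eqxx (negbTE vW) andbF.
Qed.

Lemma blk_inl e : blk (inl e) = if (#|val e :&: W| == 1)%N then set0 else [set e].
Proof.
have lab e' : star_label e' = inl e -> e' = e /\ #|val e :&: W| != 1%N.
  rewrite /star_label; case: pickP => // h [<-]; split=> //.
  by apply/negP => /cards1P[v] /eqP; rewrite h.
apply/setP => e'; rewrite inE; apply/eqP/idP => [/lab[-> /negbTE ->]|].
  by rewrite inE.
case: ifP => [|h]; first by rewrite inE.
rewrite inE => /eqP ->; rewrite /star_label; case: pickP => // v /eqP hv.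
by rewrite hv cards1 in h.
Qed.

Lemma prod_label (F : vpair n + 'I_n -> R) :
  \prod_i F i = (\prod_e F (inl e)) * \prod_v F (inr v).
Proof. by rewrite big_sumType. Qed.

Lemma prod_vpair s e : sgn R (same_spin s e) = \prod_(v in val e) spin R s v.
Proof.
have /cards2P[u [v [uv E]]] := valP e.
rewrite E big_setU1 ?inE // big_set1 /spin.
have -> : same_spin s e = (s u == s v).
  rewrite /same_spin; apply/idP/eqP => [|suv].
    move=> /forallP/(_ u); rewrite E !inE eqxx /= => /forallP/(_ v).
    by rewrite !inE eqxx orbT /= => /eqP.
  apply/forallP => i; apply/implyP; rewrite E !inE => /orP[]/eqP ->;
  apply/forallP => j; apply/implyP; rewrite !inE => /orP[]/eqP ->; by rewrite ?suv eqxx.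
by rewrite /sgn; case: (s u); case: (s v) => /=; ring.
Qed.

Lemma sum_vpair (P : pred {set 'I_n}) (F : {set 'I_n} -> R) :
  \sum_(e : vpair n | P (val e)) F (val e) =
  \sum_(N : {set 'I_n} | (#|N| == 2)%N && P N) F N.
Proof.
rewrite [RHS](reindex_omap (val : vpair n -> {set 'I_n}) insub) /=.
  by apply: eq_bigl => e; rewrite (valP e) valK eqxx andbT.
by move=> N /andP[N2 _]; rewrite insubT.
Qed.

Lemma sum_star v (F : {set 'I_n} -> R) : v \in W ->
  \sum_(e in blk (inr v)) F (val e) = \sum_(u in ~: W) F [set v; u].
Proof.
move=> vW; rewrite blk_inr.
under eq_bigl => e do rewrite inE.
rewrite (sum_vpair (fun N => N :&: W == [set v])).
rewrite (reindex_onto (fun u => [set v; u]) (fun N => odflt v [pick u in N :\ v])) /=.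
  apply: eq_bigl => u; rewrite cards2 inE.
  apply/idP/idP => [/andP[/andP[vu /eqP/setP hN] _]|uW].
    move: vu; have := hN u; rewrite !inE eqxx orbT /= => ->.
    by rewrite [u == v]eq_sym; case: (v == u).
  have vu : v != u by apply/eqP => uv; rewrite -uv vW in uW.
  rewrite vu /=; apply/andP; split.
    apply/eqP/setP => z; rewrite !inE.
    case: (eqVneq z v) => [->|zv] /=; first by rewrite vW.
    by case: (eqVneq z u) => [->|_] //=; rewrite (negbTE uW).
  case: pickP => [z|/(_ u)] /=; last by rewrite !inE eqxx orbT eq_sym vu.
  by rewrite !inE => /andP[/negbTE ->] /= /eqP ->.
move=> N /andP[/cards2P[a [b [ab ->]]] /eqP hN].
have : v \in [set a; b] by have /setP/(_ v) := hN; rewrite !inE eqxx => /andP[].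
rewrite !inE => /orP[]/eqP va; subst v.
  case: pickP => [z|/(_ b)] /=; last by rewrite !inE eqxx orbT eq_sym ab.
  by rewrite !inE => /andP[/negbTE ->] /= /eqP ->.
case: pickP => [z|/(_ a)] /=; last by rewrite !inE eqxx ab.
by rewrite !inE => /andP[/negbTE ->]; rewrite orbF => /eqP ->; rewrite setUC.
Qed.

Lemma sum_star_sgn v s : v \in W ->
  \sum_(e in blk (inr v)) sgn R (same_spin s e) = spin R s v * mag R (~: W) s.
Proof.
move=> vW; under eq_bigr => e _ do rewrite prod_vpair.
rewrite (sum_star (fun N => \prod_(u in N) spin R s u)) // /mag mulr_sumr.
apply: eq_bigr => u; rewrite inE => uW; rewrite big_setU1 ?big_set1 // inE.
by apply/eqP => uv; rewrite uv (negbTE uW) in vW.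
Qed.

Lemma sum_star_overlap v s t : v \in W ->
  \sum_(e in blk (inr v)) sgn R (same_spin s e) * sgn R (same_spin t e) =
  spin R (overlap s t) v * mag R (~: W) (overlap s t).
Proof.
move=> vW; rewrite -sum_star_sgn //; apply: eq_bigr => e _.
by rewrite !prod_vpair -big_split /=; apply: eq_bigr => u _; rewrite spin_overlap.
Qed.

Lemma card_star v : v \in W -> #|blk (inr v)| = #|~: W|.
Proof.
move=> vW; have := sum_star (fun=> 1) vW.
by rewrite !sumr_const => /eqP; rewrite eqr_nat => /eqP.
Qed.

(** Such a pair lies inside [W] or inside its complement. Newton's identity applies on each side,
    and dropping the diagonals gives the inequality. *)
Lemma sum_nonstar s : \sum_(e : vpair n | (#|val e :&: W| != 1)%N) sgn R (same_spin s e) <=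
  (mag R W s ^+ 2 + mag R (~: W) s ^+ 2) / 2.
Proof.
under eq_bigr => e _ do rewrite prod_vpair.
rewrite (sum_vpair (fun N => #|N :&: W| != 1)%N (fun N => \prod_(u in N) spin R s u)).
rewrite (bigID (fun N : {set 'I_n} => N \subset W)) /=.
have -> : \sum_(N : {set 'I_n} | (#|N| == 2)%N && (#|N :&: W| != 1)%N && (N \subset W))
    \prod_(u in N) spin R s u = (mag R W s ^+ 2 - \sum_(v in W) spin R s v ^+ 2) / 2.
  rewrite -sum_card2_prod; apply: eq_bigl => N; rewrite andbC.
  case: (boolP (N \subset W)) => //= NW; rewrite (setIidPl NW).
  by case: eqP => // ->.
have -> : \sum_(N : {set 'I_n} | (#|N| == 2)%N && (#|N :&: W| != 1)%N && ~~ (N \subset W))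
    \prod_(u in N) spin R s u = (mag R (~: W) s ^+ 2 - \sum_(v in ~: W) spin R s v ^+ 2) / 2.
  rewrite -sum_card2_prod; apply: eq_bigl => N.
  apply/idP/idP => [/andP[/andP[/eqP N2 N1] NW]|/andP[NW N2]].
    rewrite N2 andbT.
    have : (#|N :&: W| < 2)%N.
      rewrite -N2; apply: proper_card; rewrite properE subsetIl /=.
      by apply: contra NW => h; apply: subset_trans h (subsetIr _ _).
    rewrite ltnS leq_eqVlt (negbTE N1) ltnS leqn0 cards_eq0 /= setI_eq0.
    by rewrite disjoints_subset.
  rewrite N2 /= (_ : N :&: W = set0) ?cards0 /=; last by apply/eqP; rewrite setI_eq0 disjoints_subset.
  apply/negP => NW'; have : N \subset W :&: ~: W by rewrite subsetI NW'.
  by rewrite setICr subset0 => /eqP N0; rewrite N0 cards0 in N2.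
have : 0 <= \sum_(v in W) spin R s v ^+ 2 by apply: sumr_ge0 => v _; exact: sqr_ge0.
have : 0 <= \sum_(v in ~: W) spin R s v ^+ 2 by apply: sumr_ge0 => v _; exact: sqr_ge0.
by move: (\sum_(v in W) _) (\sum_(v in ~: W) _) => a b; lra.
Qed.

End Model.

(** * The adversary and the factorised second moment of the observed graph *)

Section Adversary.
Variables (R : realType) (n : nat) (W : {set 'I_n}).
Implicit Types (s t : spins n) (e : vpair n) (G : graph n) (v : 'I_n).
Local Notation blk := (blk W).

(** Since [cut] only alters sets of two edges, it is the identity on single-edge blocks; the stars
    are treated independently. *)
Definition star_cut (g : R) s (Gpre G : graph n) : R :=
  \prod_i cut g (same_spin s) (Gpre :&: blk i) (G :&: blk i).

Lemma star_cut_ge0 g s Gpre G : 0 <= g <= 1 -> 0 <= star_cut g s Gpre G.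
Proof. by move=> g01; apply: prodr_ge0 => i _; exact: cut_ge0. Qed.

Lemma star_cut_sum1 g s Gpre : \sum_G star_cut g s Gpre G = 1.
Proof.
rewrite (sum_blocks (star_label W) (fun i => cut g (same_spin s) (Gpre :&: blk i))).
by rewrite big1 // => i _; rewrite cut_sum1 // subsetIr.
Qed.

Lemma star_cut_monotone g s Gpre G : star_cut g s Gpre G != 0 -> monotone_change s Gpre G.
Proof.
move=> /prodf_neq0 h; apply/forallP => e.
have := cut_monotone (h (star_label W e) isT) e.
by rewrite !inE eqxx !andbT.
Qed.

Definition star_adversary (g : R) (g01 : 0 <= g <= 1) : monotone_adversary R n :=
  MonotoneAdversary (fun s Gpre G => star_cut_ge0 s Gpre G g01) (star_cut_sum1 g)
    (@star_cut_monotone g).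

Section Law.
Variables (a b g : R) (g01 : 0 <= g <= 1).

Definition pr (c : bool) : R := if c then edge_prob a n else edge_prob b n.

Lemma sbm_blocks s G :
  sbm a b s G = 2^-1 ^+ n * \prod_i block_pre pr (blk i) (same_spin s) (G :&: blk i).
Proof.
rewrite /sbm (partition_big (star_label W) predT) //=; congr (_ * _).
apply: eq_bigr => i _; rewrite /block_pre.
apply: eq_big => [e|e /eqP ei]; first by rewrite inE.
by rewrite !inE ei eqxx andbT.
Qed.

Lemma semirandom_blocks s G :
  semirandom a b (star_adversary g01) s G =
  2^-1 ^+ n * \prod_i block_law g pr (blk i) (same_spin s) (G :&: blk i).
Proof.
rewrite /semirandom /=.
under eq_bigr => Gpre _ do rewrite sbm_blocks /star_cut -mulrA -big_split /=.
rewrite -mulr_sumr; congr (_ * _).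
exact: (sum_blocks (star_label W) (fun i N => block_pre pr (blk i) (same_spin s) N *
  cut g (same_spin s) N (G :&: blk i))).
Qed.

Lemma sbm_sum s : \sum_G sbm a b s G = 2^-1 ^+ n.
Proof.
under eq_bigr => G _ do rewrite sbm_blocks.
rewrite -mulr_sumr -[RHS]mulr1; congr (_ * _).
rewrite (sum_blocks (star_label W) (fun i => block_pre pr (blk i) (same_spin s))).
rewrite big1 // => i _; rewrite sum_subset_prod big1 // => e _; ring.
Qed.

Lemma semirandom_sum s : \sum_G semirandom a b (star_adversary g01) s G = 2^-1 ^+ n.
Proof.
rewrite /semirandom exchange_big /= -(sbm_sum s); apply: eq_bigr => Gpre _.
by rewrite -mulr_sumr star_cut_sum1 mulr1.
Qed.

Lemma semirandom_ge0 s G : (forall c, 0 <= pr c <= 1) ->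
  0 <= semirandom a b (star_adversary g01) s G.
Proof.
move=> h; rewrite semirandom_blocks mulr_ge0 ?exprn_ge0 ?invr_ge0 //.
apply: prodr_ge0 => i _; apply: sumr_ge0 => N _.
by rewrite mulr_ge0 ?block_pre_ge0 ?cut_ge0.
Qed.

Definition ref_graph (p chi : R) G : R := \prod_i block_ref p chi (blk i) (G :&: blk i).

Lemma ref_graph_gt0 p chi G : 0 < p -> p <= 1 / 2 -> 0 <= chi -> chi <= 1 / 2 ->
  0 < ref_graph p chi G.
Proof. by move=> *; apply: prodr_gt0 => i _; apply: block_ref_gt0. Qed.

Lemma ref_graph_sum p chi : \sum_G ref_graph p chi G = 1.
Proof.
rewrite (sum_blocks (star_label W) (fun i => block_ref p chi (blk i))).
by rewrite big1 // => i _; exact: block_ref_sum.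
Qed.

Definition moment p chi s t : R :=
  \prod_i block_moment p chi g pr (blk i) (same_spin s) (same_spin t).

(** Both laws and the reference law are products over the same blocks; [4^-1 ^+ n] comes from the
    two uniform spin priors. *)
Lemma momentE p chi s t :
  \sum_G semirandom a b (star_adversary g01) s G *
    semirandom a b (star_adversary g01) t G / ref_graph p chi G =
  4^-1 ^+ n * moment p chi s t.
Proof.
rewrite /moment /block_moment -(sum_blocks (star_label W)
  (fun i N => block_law g pr (blk i) (same_spin s) N *
     block_law g pr (blk i) (same_spin t) N / block_ref p chi (blk i) N)).
rewrite mulr_sumr; apply: eq_bigr => G _.
rewrite !semirandom_blocks /ref_graph big_split prodfV big_split /=.
have -> : (4^-1 : R) ^+ n = 2^-1 ^+ n * 2^-1 ^+ n by rewrite -exprMn; congr (_ ^+ _); field.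
ring.
Qed.

End Law.

Section Bound.
Variables (p th chi g : R) (prb : bool -> R).
Hypotheses (p0 : 0 < p) (p1 : p <= 1 / 2) (th0 : 0 < th) (th1 : th < 1).
Hypotheses (chi0 : 0 <= chi) (chi1 : chi <= 1 / 2).
Hypothesis prE : forall b, prb b = p * (1 + th * sgn R b).
Local Notation tt := (p * th / (1 - p)).
Hypothesis gE : g * (1 - th) ^+ 2 = 4 * chi * (1 + tt) ^+ 2.
Local Notation lam := (th ^+ 2 * p / (1 - p)).

Definition star_weight : R := chi * (p ^+ 2 * (1 - p) ^+ (#|~: W| - 2)) * (#|~: W|%:R ^+ 2 / 2).

Lemma lam_bounds : 0 <= lam /\ lam <= 1.
Proof.
have q : 0 < 1 - p by move: p1; lra.
split; first by rewrite divr_ge0 ?mulr_ge0 ?sqr_ge0 ?ltW.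
rewrite ler_pdivrMr // mul1r; move: p0 p1 th0 th1; nra.
Qed.

Lemma nonstar_moment_le s t :
  \prod_e block_moment p chi g prb (blk (inl e)) (same_spin s) (same_spin t) <=
  expR (lam * ((mag R W (overlap s t) ^+ 2 + mag R (~: W) (overlap s t) ^+ 2) / 2)).
Proof.
have [l0 l1] := lam_bounds.
have xx e : sgn R (same_spin s e) * sgn R (same_spin t e) = sgn R (same_spin (overlap s t) e).
  by rewrite !prod_vpair -big_split /=; apply: eq_bigr => u _; rewrite spin_overlap.
apply: (@le_trans _ _ (\prod_(e : vpair n | (#|val e :&: W| != 1)%N)
    expR (lam * sgn R (same_spin (overlap s t) e)))).
  rewrite [leRHS]big_mkcond /=; apply: ler_prod => e _.
  rewrite (block_moment_small chi g p0 p1 prE); last first.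
    by rewrite blk_inl; case: ifP; rewrite ?cards0 ?cards1.
  rewrite blk_inl; case: ifP => /= h; first by rewrite big_set0 ler01 lexx.
  rewrite big_set1 xx expR_ge1Dx andbT.
  by rewrite /sgn; case: ifP => _; lra.
rewrite -expR_sum -mulr_sumr ler_expR; apply: ler_wpM2l => //.
exact: sum_nonstar.
Qed.

Lemma prb_bounds c : 0 <= prb c <= 1.
Proof.
by rewrite prE /sgn; move: p0 p1 th0 th1; case: c => *; nra.
Qed.

Lemma block_moment_ge0 (B : {set vpair n}) (c c' : pred (vpair n)) : 0 <= g <= 1 ->
  0 <= block_moment p chi g prb B c c'.
Proof.
move=> g01; apply: sumr_ge0 => N _; rewrite divr_ge0 //; last first.
  by apply: ltW; apply: block_ref_gt0.
by rewrite mulr_ge0 //; apply: sumr_ge0 => M _;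
  rewrite mulr_ge0 ?cut_ge0 // block_pre_ge0 // => d; exact: prb_bounds.
Qed.

(* Bound for the second moment of a star, at [z] = (overlap at its centre) times
   (mean overlap outside [W]). *)
Definition Psi (al a1 b1 kap z : R) : R := expR (al * z) + a1 * z - b1 * z ^+ 2 + kap.

(** Typicality is required only outside [W]: the spin of a centre enters the sum of signs of its
    star as a global sign. *)
Lemma graph_moment_le s t (z kk : R) : 0 <= g <= 1 -> (2 <= #|~: W|)%N ->
  1 <= kk -> 0 < z -> small_deviation kk z ->
  1 <= z * #|~: W|%:R -> 4 * tt <= z -> tt * #|~: W|%:R <= 2 * kk ->
  #|~: W|%:R * tt ^+ 2 <= z -> p * #|~: W|%:R <= kk ->
  `|mag R (~: W) s| <= z * #|~: W|%:R -> `|mag R (~: W) t| <= z * #|~: W|%:R ->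
  \prod_i block_moment p chi g prb (blk i) (same_spin s) (same_spin t) <=
  expR (lam * ((mag R W (overlap s t) ^+ 2 + mag R (~: W) (overlap s t) ^+ 2) / 2)) *
  \prod_(v in W) Psi (lam * #|~: W|%:R) (star_weight * gain1 th chi)
     (star_weight * gain2 th chi) (block_error kk z)
     (spin R (overlap s t) v * (mag R (~: W) (overlap s t) / #|~: W|%:R)).
Proof.
move=> g01 U2 k1 z0 kz zm tz tm t2 pm ms mt.
have m0 : 0 < #|~: W|%:R :> R by rewrite ltr0n (leq_trans _ U2).
rewrite prod_label; apply: ler_pM; try by apply: prodr_ge0 => i _; exact: block_moment_ge0.
  exact: nonstar_moment_le.
rewrite [leRHS]big_mkcond /=; apply: ler_prod => v _; rewrite block_moment_ge0 //=.
case: (boolP (v \in W)) => vW; last first.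
  rewrite blk_inr_out // (block_moment_small chi g p0 p1 prE) ?cards0 //.
  by rewrite big_set0.
have cE := card_star R vW.
set y := spin R (overlap s t) v * (mag R (~: W) (overlap s t) / #|~: W|%:R).
have yE : y * #|~: W|%:R = spin R (overlap s t) v * mag R (~: W) (overlap s t).
  by rewrite /y -mulrA divfK // gt_eqF.
have := @block_moment_le R _ p th chi g prb p0 p1 th0 th1 chi0 chi1 prE gE (blk (inr v))
  (same_spin s) (same_spin t) z kk.
rewrite cE => /(_ U2 k1 z0 kz zm tz tm t2 pm).
rewrite !sum_star_sgn // !normrM /spin !norm_sgn !mul1r => /(_ ms mt y).
rewrite sum_star_overlap // yE => /(_ erefl) /le_trans; apply.
have wE : weight p chi (blk (inr v)) = star_weight by rewrite /weight /pair_ref cE.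
rewrite le_eqVlt; apply/orP; left; apply/eqP; rewrite /Psi wE -yE.
have -> : lam * (y * #|~: W|%:R) = lam * #|~: W|%:R * y by ring.
ring.
Qed.

End Bound.
End Adversary.

(** * Averaging the second moment over the overlap *)

Section SpinSums.
Variable R : realType.
Implicit Types (al a b kap m y L x dl t : R).

Lemma sinhR_le y : 0 <= y <= 1 / 2 -> (expR y - expR (- y)) / 2 <= 2 * y.
Proof.
move=> /andP[y0 y1]; have := expR_mul_le1 y; have := expR_ge1Dx (- y).
have := expR_gt0 y; move: (expR y) (expR (- y)) => u v u0 h1 h2.
have : u <= 1 + 2 * y by nra.
lra.
Qed.

Lemma coshR_le2 y : `|y| <= 1 / 2 -> coshR y <= 2.
Proof.
move=> h; apply: le_trans (coshR_le_expR _) _.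
have y2 : y ^+ 2 <= 1 / 4 by move: h; rewrite ler_norml => /andP[]; nra.
have := expR_mul_le1 (y ^+ 2 / 2); have := expR_gt0 (y ^+ 2 / 2).
move: (expR _) => u u0 hu; nra.
Qed.

(** Averaging over the spin of the centre, tilted by the field [y], turns the exponential into
    [coshR (al * m + y)] and leaves of the linear term only a part proportional to [sinh y]. Placing
    the gain inside the exponential costs the factor [expR (-2)], because the main exponent is at
    most two. *)
Lemma Psi_average al a b kap m y : `|m| <= 1 -> `|y| <= 1 / 2 -> 0 <= al <= 3 / 2 ->
  0 <= a -> 0 <= b -> 0 <= kap ->
  (Psi al a b kap m * expR y + Psi al a b kap (- m) * expR (- y)) / 2 <=
  expR ((al * m + y) ^+ 2 / 2 + 2 * a * (`|m| * `|y|) + 2 * kap - b * expR (-2) * m ^+ 2).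
Proof.
move=> m1 y1 /andP[al0 al1] a0 b0 k0.
have -> : (Psi al a b kap m * expR y + Psi al a b kap (- m) * expR (- y)) / 2 =
    coshR (al * m + y) + a * (m * ((expR y - expR (- y)) / 2)) + (kap - b * m ^+ 2) * coshR y.
  by rewrite /Psi /coshR opprD !expRD mulrN sqrrN; field.
have cy2 := coshR_le2 y1; have cy1 := coshR_ge1 y.
have sh : m * ((expR y - expR (- y)) / 2) <= 2 * (`|m| * `|y|).
  have [y0|y0] := leP 0 y.
    have h := @sinhR_le y; rewrite y0 /= in h.
    have {}h := h (le_trans (ler_norm _) y1).
    rewrite (ger0_norm y0).
    have s0 : 0 <= (expR y - expR (- y)) / 2.
      by apply: divr_ge0 => //; rewrite subr_ge0 ler_expR; lra.
    apply: le_trans (_ : `|m| * (2 * y) <= _); last by lra.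
    by apply: le_trans (ler_wpM2r s0 (ler_norm m)) _; exact: ler_wpM2l.
  have h := @sinhR_le (- y); rewrite opprK in h.
  have {}h : (expR (- y) - expR y) / 2 <= 2 * - y.
    by apply: h; move: y1; rewrite ltr0_norm // => ?; apply/andP; split; lra.
  rewrite (ltr0_norm y0).
  have s0 : 0 <= (expR (- y) - expR y) / 2.
    by apply: divr_ge0 => //; rewrite subr_ge0 ler_expR; lra.
  have -> : m * ((expR y - expR (- y)) / 2) = - m * ((expR (- y) - expR y) / 2) by ring.
  apply: le_trans (_ : `|m| * (2 * - y) <= _); last by lra.
  apply: le_trans (ler_wpM2r s0 (_ : - m <= `|m|)) _; first by rewrite -normrN ler_norm.
  exact: ler_wpM2l.
set X := al * m + y.
have X2 : X ^+ 2 / 2 <= 2.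
  have : `|X| <= 2.
    apply: le_trans (ler_normD _ _) _; rewrite normrM (ger0_norm al0).
    have : al * `|m| <= 3 / 2 * 1 by exact: ler_pM.
    by lra.
  by rewrite ler_norml => /andP[]; nra.
have cX := coshR_le_expR X.
set E := expR (X ^+ 2 / 2) in cX *.
have E1 : 1 <= E by have := expR_ge1Dx (X ^+ 2 / 2); have := sqr_ge0 X; rewrite -/E; lra.
have Em : expR (-2) * E <= 1.
  by rewrite /E -expRD expR_le1; lra.
have m2 : 0 <= b * m ^+ 2 by rewrite mulr_ge0 ?sqr_ge0.
set P := 2 * a * (`|m| * `|y|) + 2 * kap.
have P0 : 0 <= P by rewrite /P addr_ge0 ?mulr_ge0.
apply: (@le_trans _ _ (E + (P - b * m ^+ 2))).
  have : a * (m * ((expR y - expR (- y)) / 2)) <= a * (2 * (`|m| * `|y|)) by exact: ler_wpM2l.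
  have : kap * coshR y <= kap * 2 by exact: ler_wpM2l.
  have : b * m ^+ 2 * 1 <= b * m ^+ 2 * coshR y by exact: ler_wpM2l.
  by rewrite /P; lra.
have -> : X ^+ 2 / 2 + 2 * a * (`|m| * `|y|) + 2 * kap - b * expR (-2) * m ^+ 2 =
  X ^+ 2 / 2 + (P - expR (-2) * (b * m ^+ 2)) by rewrite /P; ring.
rewrite expRD -/E; apply: le_trans (ler_wpM2l (expR_ge0 _) (expR_ge1Dx _)).
have : P <= E * P by rewrite ler_peMl.
have : expR (-2) * E * (b * m ^+ 2) <= 1 * (b * m ^+ 2) by exact: ler_wpM2r.
rewrite -/E; lra.
Qed.

(* [dl] is the fraction of vertices in [W], [m] the mean overlap outside [W] and
   [y] the field that linearises the interaction inside [W]. *)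
Lemma exponent_le dl m y al a b L x kap t :
  0 < dl -> 6 * dl <= 1 -> 52 * dl <= b -> 0 <= b <= 1 -> 0 <= x -> 4 * x <= dl * b ->
  L = 1 + x -> 0 <= al <= L * (1 - dl) -> 0 <= a <= 1 -> 1 - t <= dl * b ->
  dl * ((al * m + y) ^+ 2 / 2 + 2 * a * (`|m| * `|y|) + 2 * kap - b * m ^+ 2)
    - y ^+ 2 / (2 * L) + L * (1 - dl) ^+ 2 * m ^+ 2 / 2 <=
  2 * dl * kap + t * (1 - dl) * m ^+ 2 / 2.
Proof.
move=> d0 d6 d52 /andP[b0 b1] x0 xb LE /andP[al0 alL] /andP[a0 a1] tb.
have x1 : x <= 1 / 2 by nra.
have L0 : 0 < L by lra.
have hy : y ^+ 2 / 3 <= y ^+ 2 / (2 * L).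
  by apply: ler_wpM2l; [exact: sqr_ge0|rewrite lef_pV2 ?posrE; lra].
rewrite -[m ^+ 2]real_normK ?num_real // -[y ^+ 2]real_normK ?num_real // in hy *.
have my : m * y <= `|m| * `|y| by rewrite -normrM ler_norm.
have -> : (al * m + y) ^+ 2 = al ^+ 2 * `|m| ^+ 2 + 2 * al * (m * y) + `|y| ^+ 2.
  by rewrite !real_normK ?num_real //; ring.
move: (normr_ge0 m) (normr_ge0 y) my hy; move: (`|m|) (`|y|) (m * y) (`|y| ^+ 2 / (2 * L)) => M Y my q M0 Y0 myM hy.
have al32 : al <= 3 / 2 by nra.
have s1 : dl * (al * my) <= dl * (3 / 2 * (M * Y)).
  apply: ler_wpM2l; first lra.
  apply: le_trans (ler_wpM2l al0 myM) _.
  by apply: ler_wpM2r => //; rewrite mulr_ge0.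
have s2 : dl * (2 * a * (M * Y)) <= dl * (2 * (M * Y)).
  by apply: ler_wpM2l; [lra|apply: ler_wpM2r; [rewrite mulr_ge0|lra]].
have s3 : dl * Y ^+ 2 / 2 <= Y ^+ 2 / 12.
  by have := sqr_ge0 Y; nra.
(* Completing the square: the cross terms add up to [7 / 2 = 3 / 2 + 2], and
   [1 / 4 = 1 / 3 - 1 / 12] is what remains of the cost of the field. *)
have s4 : dl * (7 / 2 * (M * Y)) - Y ^+ 2 / 4 <= 13 * dl ^+ 2 * M ^+ 2.
  have := sqr_ge0 (7 / 2 * dl * M - Y / 2); have := sqr_ge0 (dl * M); lra.
have c1 : al ^+ 2 <= L ^+ 2 * (1 - dl) ^+ 2.
  by rewrite -exprMn lerXn2r ?nnegrE //; lra.
(* At [x = 0] the left side is [(1 - dl) ^ 2 * (1 + dl)], at most [1 - dl]: without the gain the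
   vertices outside [W] are at most critical, so the gain has to beat only [x] and the terms of
   order [dl ^ 2]. *)
have c2 : (1 - dl) ^+ 2 * (L + dl * L ^+ 2) <= 1 - dl + 2 * x.
  have : L + dl * L ^+ 2 <= 1 + dl + 2 * x by rewrite LE; nra.
  move=> h; apply: le_trans (ler_wpM2l (sqr_ge0 _) h) _.
  have : 0 <= (1 - dl) * dl ^+ 2 by apply: mulr_ge0; [lra|exact: sqr_ge0].
  have : 0 <= x * (dl * (2 - dl)) by apply: mulr_ge0 => //; apply: mulr_ge0; lra.
  by lra.
have c3 : 13 * dl ^+ 2 <= dl * b / 4 by nra.
have co : dl * al ^+ 2 / 2 + L * (1 - dl) ^+ 2 / 2 + 13 * dl ^+ 2 - dl * b <= t * (1 - dl) / 2.
  have : dl * al ^+ 2 <= dl * (L ^+ 2 * (1 - dl) ^+ 2) by apply: ler_wpM2l => //; lra.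
  have : (1 - t) * (1 - dl) <= dl * b by nra.
  by lra.
have : M ^+ 2 * (dl * al ^+ 2 / 2 + L * (1 - dl) ^+ 2 / 2 + 13 * dl ^+ 2 - dl * b) <=
  M ^+ 2 * (t * (1 - dl) / 2) by apply: ler_wpM2l => //; exact: sqr_ge0.
by lra.
Qed.

Section Sums.
Variables (n : nat) (W : {set 'I_n}).
Implicit Types (r s : spins n).

Lemma mag_nat s : exists2 j, (j <= (2 * #|W|))%N & mag R W s = j%:R - #|W|%:R.
Proof.
exists (2 * #|[set v in W | s v]|)%N.
  by rewrite leq_mul2l /=; apply: subset_leq_card; apply/subsetP => v; rewrite inE => /andP[].
rewrite /mag (big_setID [set v | s v]) /=.
rewrite [X in X + _](eq_bigr (fun=> 1)) => [|v]; last first.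
  by rewrite !inE /spin => /andP[_ ->].
rewrite [X in _ + X](eq_bigr (fun=> - 1)) => [|v]; last first.
  by rewrite !inE /spin => /andP[/negbTE -> _].
rewrite sumrN !sumr_const.
have -> : [set v in W | s v] = W :&: [set v | s v] by apply/setP => v; rewrite !inE.
rewrite -(cardsID [set v | s v] W) natrM natrD; ring.
Qed.

(** A discrete substitute for Gaussian linearisation: the index [j] that matches the magnetization
    gives equality and the other terms are positive. The loss is only the number of terms, linear in
    [#|W|]. *)
Lemma expR_sqr_le_sum (c : R) s : 0 <= c ->
  expR (c * mag R W s ^+ 2) <= \sum_(j < (2 * #|W|).+1)
    expR (2 * c * (j%:R - #|W|%:R) * mag R W s - c * (j%:R - #|W|%:R) ^+ 2).
Proof.
move=> c0; have [j hj ->] := mag_nat s.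
rewrite (bigD1 (inord j)) //= inordK //.
rewrite ler_wpDr //; first by apply: sumr_ge0 => i _; exact: expR_ge0.
by rewrite ler_expR; lra.
Qed.

Lemma sum_spins_exp_sqr (c : R) (f : R -> R) : 0 <= c -> 0 <= f 1 -> 0 <= f (-1) ->
  \sum_(s : spins n) expR (c * mag R W s ^+ 2) * \prod_(v in W) f (spin R s v) <=
  2 ^+ n * \sum_(j < (2 * #|W|).+1) expR (- (c * (j%:R - #|W|%:R) ^+ 2)) *
    ((f 1 * expR (2 * c * (j%:R - #|W|%:R)) +
      f (-1) * expR (- (2 * c * (j%:R - #|W|%:R)))) / 2) ^+ #|W|.
Proof.
move=> c0 f1 f2.
apply: (@le_trans _ _ (\sum_(s : spins n) \sum_(j < (2 * #|W|).+1)
    expR (- (c * (j%:R - #|W|%:R) ^+ 2)) *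
    \prod_(v in W) (f (spin R s v) * expR (2 * c * (j%:R - #|W|%:R) * spin R s v)))).
  apply: ler_sum => s _.
  have p0 : 0 <= \prod_(v in W) f (spin R s v).
    by apply: prodr_ge0 => v _; rewrite /spin /sgn; case: ifP.
  apply: le_trans (ler_wpM2r p0 (expR_sqr_le_sum _ c0)) _.
  rewrite mulr_suml; apply: ler_sum => j _.
  rewrite big_split /= -expR_sum -mulr_sumr -/(mag R W s) addrC expRD.
  by rewrite le_eqVlt; apply/orP; left; apply/eqP; ring.
rewrite exchange_big mulr_sumr; apply: ler_sum => j _ /=.
rewrite -mulr_sumr [leRHS]mulrCA; apply: ler_wpM2l; first exact: expR_ge0.
set y := 2 * c * _.
pose F (v : 'I_n) (b : bool) : R := if v \in W then f (sgn R b) * expR (y * sgn R b) else 1.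
have -> : \sum_(s : spins n) \prod_(v in W) (f (spin R s v) * expR (y * spin R s v)) =
    \sum_(s : spins n) \prod_v F v (s v).
  by apply: eq_bigr => s _; rewrite big_mkcond.
rewrite sum_spins_prod.
have -> : \prod_v (F v true + F v false) =
    \prod_(v : 'I_n) (2 * if v \in W then (f 1 * expR y + f (-1) * expR (- y)) / 2 else 1).
  apply: eq_bigr => v _; rewrite /F /sgn; case: ifP => _; last by ring.
  by rewrite mulr1 mulrN1; field.
rewrite big_split /= prodr_const card_ord; apply: ler_wpM2l; first exact: exprn_ge0.
by rewrite -big_mkcond /= prodr_const.
Qed.

(** With the spins outside [W] frozen, [exponent_le] bounds the sum over [W] by
    [expR (t * u * m ^ 2 / 2)] up to explicit factors. As [t < 1], the remaining exponential moment
    is bounded uniformly in [n]. *)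
Lemma spin_sum_le al a b L x kap t : (0 < n)%N ->
  let N := n%:R : R in let w := #|W|%:R : R in let u := #|~: W|%:R : R in
  let dl := w / N in let b' := b * expR (-2) in
  0 < w -> 6 * dl <= 1 -> 52 * dl <= b' -> 0 <= b <= 1 -> 0 <= x -> 4 * x <= dl * b' ->
  L = 1 + x -> 0 <= al <= L * (1 - dl) -> 0 <= a <= 1 -> 0 <= kap ->
  0 < t < 1 -> 1 - t <= dl * b' ->
  (forall z, `|z| <= 1 -> 0 <= Psi al a b kap z) ->
  \sum_(r : spins n) expR (L / (2 * N) * (mag R W r ^+ 2 + mag R (~: W) r ^+ 2)) *
    \prod_(v in W) Psi al a b kap (spin R r v * (mag R (~: W) r / u)) <=
  2 ^+ n * (2 * w + 1) * expR (2 * w * kap) * expR (t / (2 * (1 - t))).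
Proof.
move=> n0 N w u dl b' w0 d6 d52 /andP[b0 b1] x0 xb LE /andP[al0 alL] /andP[a0 a1] k0 /andP[t0 t1] tb hPsi.
have N0 : 0 < N by rewrite /N ltr0n.
have uE : u = N - w.
  have : N = w + u by rewrite /N /w /u -natrD cardsC card_ord.
  by lra.
have wE : w = dl * N by rewrite /dl divfK // gt_eqF.
have u0 : 0 < u by rewrite uE wE -subr_gt0; nra.
have dl0 : 0 < dl by rewrite divr_gt0.
have e2 : 0 < (expR (-2) : R) <= 1 by rewrite expR_gt0 expR_le1; lra.
have b'01 : 0 <= b' <= 1 by rewrite /b'; move: (expR _) e2 => q /andP[? ?]; apply/andP; split; nra.
have L0 : 0 < L by lra.
have x1 : x <= 1 / 24 by case/andP: b'01 => ? ?; nra.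
rewrite -(ler_pM2l (exprn_gt0 n (ltr0n R 2))) (sum_merge W).
apply: (@le_trans _ _ (\sum_(r : spins n) 2 ^+ n * ((2 * w + 1) * expR (2 * w * kap)) *
    expR (mag R (~: W) r ^+ 2 / (2 * (u / t))))); last first.
  rewrite -mulr_sumr; apply: le_trans (ler_wpM2l _ (exp_moment_mag (A := ~: W) _)) _.
  - by rewrite !mulr_ge0 ?expR_ge0 ?exprn_ge0 //; lra.
  - by rewrite -/u ltr_pdivlMr // -[ltRHS]mulr1 ltr_pM2l.
  have -> : u / (2 * (u / t - u)) = t / (2 * (1 - t)).
    have nt : t != 0 by rewrite gt_eqF.
    have nu : u != 0 by rewrite gt_eqF.
    have n1 : 1 - t != 0 by rewrite gt_eqF // subr_gt0.
    have -> : u / t - u = u * (1 - t) / t by field; rewrite nt.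
    by field; rewrite ?nt ?n1 ?nu.
  by rewrite le_eqVlt; apply/orP; left; apply/eqP; ring.
apply: ler_sum => r _.
under eq_bigr => r' _.
  rewrite mag_merge_in mag_merge_out mulrDr expRD.
  rewrite (eq_bigr (fun v => Psi al a b kap (spin R r' v * (mag R (~: W) r / u)))); last first.
    by move=> v vW; rewrite /spin ffunE vW.
  rewrite mulrAC; over.
rewrite -mulr_suml.
set m := mag R (~: W) r / u.
have m1 : `|m| <= 1.
  by rewrite /m normrM normfV (gtr0_norm u0) ler_pdivrMr // mul1r norm_mag_le.
have mE : mag R (~: W) r = u * m by rewrite /m mulrC divfK // gt_eqF.
have c0 : 0 <= L / (2 * N) by rewrite divr_ge0 ?mulr_ge0 // ltW.
have := @sum_spins_exp_sqr (L / (2 * N)) (fun q => Psi al a b kap (q * m)) c0.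
rewrite mul1r mulN1r => /(_ (hPsi _ m1)); rewrite -normrN in m1 *.
move=> /(_ (hPsi _ m1)); rewrite normrN in m1 => h.
apply: le_trans (ler_wpM2r (expR_ge0 _) h) _ => {h}.
rewrite -[leLHS]mulrA -[leRHS]mulrA ler_pM2l ?exprn_gt0 // mulr_suml -[leRHS]mulrA.
have -> : (2 * w + 1) * (expR (2 * w * kap) * expR (mag R (~: W) r ^+ 2 / (2 * (u / t)))) =
   \sum_(j < (2 * #|W|).+1) (expR (2 * w * kap) * expR (mag R (~: W) r ^+ 2 / (2 * (u / t)))).
  rewrite sumr_const card_ord -[RHS]mulr_natl; congr (_ * _).
  by rewrite -[in RHS]addn1 natrD natrM.
apply: ler_sum => j _.
set J := j%:R - #|W|%:R.
have Jw : `|J| <= w.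
  have : (j <= 2 * #|W|)%N by rewrite -ltnS.
  by rewrite -(ler_nat R) natrM /J /w ler_norml => ?; apply/andP; split; have : 0 <= j%:R :> R by []; lra.
set y := 2 * (L / (2 * N)) * J.
have yE : y = L * (J / N) by rewrite /y; field; rewrite gt_eqF.
have y1 : `|y| <= 1 / 2.
  rewrite yE normrM (gtr0_norm L0) normrM normfV (gtr0_norm N0).
  have : `|J| / N <= dl by rewrite /dl ler_pM2r ?invr_gt0.
  have : 0 <= `|J| / N by rewrite divr_ge0 // ltW.
  by move: (_ / N) => q; nra.
have al32 : 0 <= al <= 3 / 2 by rewrite al0 /=; nra.
have av := Psi_average m1 y1 al32 a0 b0 k0.
have av0 : 0 <= (Psi al a b kap m * expR y + Psi al a b kap (- m) * expR (- y)) / 2.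
  rewrite divr_ge0 // addr_ge0 ?mulr_ge0 ?expR_ge0 // hPsi //.
  by rewrite normrN.
have avw : ((Psi al a b kap m * expR y + Psi al a b kap (- m) * expR (- y)) / 2) ^+ #|W| <=
  expR (w * ((al * m + y) ^+ 2 / 2 + 2 * a * (`|m| * `|y|) + 2 * kap - b' * m ^+ 2)).
  rewrite expRM_natl lerXn2r ?nnegrE ?expR_ge0 //.
apply: le_trans (ler_wpM2r (expR_ge0 _) (ler_wpM2l (expR_ge0 _) avw)) _.
rewrite -!expRD ler_expR mE.
have ex := @exponent_le dl m y al a b' L x kap t dl0 d6 d52 b'01 x0 xb LE.
rewrite al0 a0 alL a1 in ex; have {}ex := ex isT isT tb.
have -> : L / (2 * N) * J ^+ 2 = N * (y ^+ 2 / (2 * L)).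
  by rewrite yE; field; rewrite !gt_eqF.
have -> : L / (2 * N) * (u * m) ^+ 2 = N * (L * (1 - dl) ^+ 2 * m ^+ 2 / 2).
  by rewrite uE wE; field; rewrite gt_eqF.
have -> : (u * m) ^+ 2 / (2 * (u / t)) = N * (t * (1 - dl) * m ^+ 2 / 2).
  have -> : (u * m) ^+ 2 / (2 * (u / t)) = t * u * m ^+ 2 / 2.
    by field; rewrite !gt_eqF.
  by rewrite uE wE; ring.
rewrite wE; move: (ler_wpM2l (ltW N0) ex).
by move: (y ^+ 2 / (2 * L)) => q; lra.
Qed.

End Sums.
End SpinSums.

(** * From recovery to a weighted second moment *)

Section Recovery.
Variables (R : realType) (n : nat).
Implicit Types (s t : spins n) (G : graph n).

Definition inner s t : R := mag R [set: 'I_n] (overlap s t).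

Lemma innerE s t : inner s t = \sum_v spin R s v * spin R t v.
Proof.
rewrite /inner /mag; apply: eq_big => [v|v _]; first by rewrite inE.
exact: spin_overlap.
Qed.

Lemma inner_agreement s t : inner s t = 2 * (agreement s t)%:R - n%:R.
Proof.
rewrite innerE (bigID (fun v => t v == s v)) /=.
rewrite (eq_bigr (fun=> 1)); last first.
  by move=> v /eqP h; rewrite /spin h /sgn; case: (s v); ring.
rewrite [X in _ + X](eq_bigr (fun=> - 1)); last first.
  by move=> v; rewrite /spin /sgn; case: (s v); case: (t v) => // _; ring.
rewrite sumrN !sumr_const.
have E : #|[pred v | t v == s v]| = agreement s t.
  by rewrite /agreement cardsE.
have E' : (agreement s t + #|[pred v | t v != s v]|)%N = n.
  by rewrite -E -[RHS]card_ord -(cardC [pred v | t v == s v]).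
have -> : #|(fun v => t v == s v)|%:R = (agreement s t)%:R :> R by rewrite -E.
have -> : #|(fun i => t i != s i)|%:R = n%:R - (agreement s t)%:R :> R.
  have : (agreement s t)%:R + #|[pred v | t v != s v]|%:R = n%:R :> R by rewrite -natrD E'.
  by move=> <-; rewrite addrC addKr.
ring.
Qed.

Lemma inner_flip s t : inner s (flip t) = - inner s t.
Proof.
rewrite !innerE -sumrN; apply: eq_bigr => v _.
by rewrite /spin ffunE /sgn; case: (t v) => /=; ring.
Qed.

(** An even power absorbs the global flip, which only changes the sign of [inner]. *)
Lemma partial_recovery_inner eta s t (q : nat) : 1 / 2 < eta -> partial_recovery eta s t ->
  ((2 * eta - 1) * n%:R) ^+ (2 * q) <= inner s t ^+ (2 * q).
Proof.
move=> e2 h; rewrite !exprM; apply: lerXn2r; rewrite ?nnegrE ?sqr_ge0 //.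
have n0 : 0 <= n%:R :> R by [].
have d0 : 0 <= (2 * eta - 1) * n%:R by apply: mulr_ge0 => //; lra.
rewrite -[leRHS]real_normK ?num_real //; apply: lerXn2r; rewrite ?nnegrE //.
case/orP: h => h.
  by apply: le_trans (ler_norm _); rewrite inner_agreement; lra.
rewrite -normrN -inner_flip; apply: le_trans (ler_norm _); rewrite inner_agreement; lra.
Qed.

Definition multi_spin (q : nat) s (f : {ffun 'I_q -> 'I_n}) : R := \prod_i spin R s (f i).

Lemma multi_spin_sqr q s f : @multi_spin q s f ^+ 2 = 1.
Proof.
rewrite -prodrXl big1 // => i _; rewrite /spin /sgn; case: (s _); ring.
Qed.

Lemma inner_pow q s t :
  inner s t ^+ q = \sum_(f : {ffun 'I_q -> 'I_n}) multi_spin s f * multi_spin t f.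
Proof.
rewrite innerE -[X in _ ^+ X]card_ord -prodr_const bigA_distr_bigA /=.
by apply: eq_bigr => f _; rewrite /multi_spin -big_split.
Qed.

(* Expand the even power of the overlap over tuples of vertices and apply
   Cauchy-Schwarz, tuple by tuple, against the reference law [P0]. *)
Lemma recovery_le (Q : spins n -> graph n -> R) (P0 : graph n -> R)
    (est : graph n -> spins n) (typ : pred (spins n)) (eta y : R) (q : nat) :
  (0 < n)%N -> 1 / 2 < eta -> 0 < y ->
  (forall s G, 0 <= Q s G) -> (forall s, \sum_G Q s G = 2^-1 ^+ n) ->
  (forall G, 0 < P0 G) -> \sum_G P0 G = 1 ->
  \sum_(s : spins n) \sum_(G : graph n | partial_recovery eta s (est G)) Q s G <=
  \sum_(s : spins n | ~~ typ s) 2^-1 ^+ n +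
  (((2 * eta - 1) * n%:R) ^+ (2 * q))^-1 *
   (\sum_(s : spins n | typ s) \sum_(t : spins n | typ t)
      inner s t ^+ (2 * q) * (\sum_G Q s G * Q t G / P0 G) / (2 * y) +
    y / 2 * n%:R ^+ (2 * q)).
Proof.
move=> n0 e2 y0 Q0 Q1 P00 P01.
have d0 : 0 < ((2 * eta - 1) * n%:R) ^+ (2 * q) by rewrite exprn_gt0 // mulr_gt0 ?ltr0n //; lra.
set D := _ ^+ (2 * q) in d0 *.
rewrite (bigID typ) /= addrC; apply: lerD.
  apply: ler_sum => s _; rewrite -(Q1 s) big_mkcond /=.
  by apply: ler_sum => G _; case: ifP.
rewrite mulrC ler_pdivlMr // mulr_suml.
apply: (@le_trans _ _ (\sum_(s : spins n | typ s) \sum_G Q s G * inner s (est G) ^+ (2 * q))).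
  apply: ler_sum => s _; rewrite mulr_suml big_mkcond /=; apply: ler_sum => G _.
  case: ifP => h; first by apply: ler_wpM2l => //; exact: partial_recovery_inner.
  by rewrite mulr_ge0 // exprM exprn_ge0 // sqr_ge0.
rewrite exchange_big /=.
pose A G f := \sum_(s : spins n | typ s) Q s G * @multi_spin (2 * q) s f.
apply: (@le_trans _ _ (\sum_G \sum_(f : {ffun 'I_(2 * q) -> 'I_n})
    (A G f ^+ 2 / (P0 G * (2 * y)) + y * P0 G / 2))).
  apply: ler_sum => G _.
  have -> : \sum_(s : spins n | typ s) Q s G * inner s (est G) ^+ (2 * q) =
      \sum_(f : {ffun 'I_(2 * q) -> 'I_n}) A G f * multi_spin (est G) f.
    under eq_bigr => s _ do rewrite inner_pow mulr_sumr.
    rewrite exchange_big /=; apply: eq_bigr => f _; rewrite /A mulr_suml.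
    by apply: eq_bigr => s _; rewrite mulrA.
  apply: ler_sum => f _; have m1 := multi_spin_sqr (est G) f.
  rewrite -subr_ge0; have pG := P00 G.
  (* The estimator disappears here: it enters only through a monomial of square one, so the
     arithmetic-geometric mean inequality with weight [y * P0 G] gives a bound free of it. *)
  have -> : A G f ^+ 2 / (P0 G * (2 * y)) + y * P0 G / 2 - A G f * multi_spin (est G) f =
    (A G f - y * P0 G * multi_spin (est G) f) ^+ 2 / (P0 G * (2 * y))
    + y * P0 G / 2 * (1 - multi_spin (est G) f ^+ 2).
    by field; rewrite !gt_eqF.
  rewrite m1 subrr mulr0 addr0 divr_ge0 ?sqr_ge0 // mulr_ge0 ?ltW //; lra.
rewrite (eq_bigr (fun G => \sum_(f : {ffun 'I_(2 * q) -> 'I_n})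
    (A G f ^+ 2 / (P0 G * (2 * y))) + P0 G * (y / 2 * n%:R ^+ (2 * q)))); last first.
  move=> G _; rewrite big_split sumr_const card_ffun !card_ord -[(_ / 2) *+ _]mulr_natr natrX /=.
  by congr (_ + _); ring.
rewrite big_split /= -mulr_suml P01 mul1r lerD2r.
rewrite le_eqVlt; apply/orP; left; apply/eqP.
transitivity (\sum_(s : spins n | typ s) \sum_(t : spins n | typ t) \sum_G
   \sum_(f : {ffun 'I_(2 * q) -> 'I_n})
     Q s G * multi_spin s f * (Q t G * multi_spin t f) / (P0 G * (2 * y))).
  rewrite (eq_bigr (fun G => \sum_(s : spins n | typ s) \sum_(t : spins n | typ t)
    \sum_(f : {ffun 'I_(2 * q) -> 'I_n})
     Q s G * multi_spin s f * (Q t G * multi_spin t f) / (P0 G * (2 * y)))).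
    by rewrite exchange_big /=; apply: eq_bigr => s _; rewrite exchange_big.
  move=> G _; rewrite [RHS](eq_bigr (fun s => \sum_(f : {ffun 'I_(2 * q) -> 'I_n})
     \sum_(t : spins n | typ t)
     Q s G * multi_spin s f * (Q t G * multi_spin t f) / (P0 G * (2 * y)))); last first.
    by move=> s _; rewrite exchange_big.
  rewrite exchange_big /=; apply: eq_bigr => f _.
  rewrite /A expr2 mulr_suml mulr_suml; apply: eq_bigr => s _.
  by rewrite mulr_sumr mulr_suml.
apply: eq_bigr => s _; apply: eq_bigr => t _.
rewrite inner_pow mulr_sumr mulr_suml; apply: eq_bigr => G _.
rewrite mulr_suml mulr_suml; apply: eq_bigr => f _.
have pG := P00 G.
by field; rewrite !gt_eqF.
Qed.

End Recovery.

(** * The tilted second moment summed over typical spins *)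

Section MomentSum.
Variable R : realType.

Lemma Psi_le (al a b b' kap z : R) : b' <= b -> Psi al a b kap z <= Psi al a b' kap z.
Proof.
by move=> h; rewrite /Psi lerD2r lerD2l lerN2 ler_wpM2r // sqr_ge0.
Qed.

(** The exponential is at least [expR (-2)] as [al <= 2]. Nonnegativity is what permits bounding
    products of these factors one by one. *)
Lemma Psi_ge0 (al a b kap z : R) : 0 <= al <= 2 -> 0 <= a -> 0 <= b -> 0 <= kap ->
  a + b <= expR (-2) -> `|z| <= 1 -> 0 <= Psi al a b kap z.
Proof.
move=> /andP[al0 al2] a0 b0 k0 ab; rewrite ler_norml => /andP[z1 z2].
have : expR (-2) <= expR (al * z) by rewrite ler_expR; nra.
have : - a <= a * z by nra.
have : b * z ^+ 2 <= b by rewrite ler_piMr //; nra.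
by rewrite /Psi; lra.
Qed.

(** The tilt by the squared total overlap couples [W] to its complement;
    [(A + B) ^ 2 <= 2 (A ^ 2 + B ^ 2)] decouples them and raises the interaction strength by
    [4 * xi]. *)
Lemma tilt_le (A B N lam x xi : R) : 0 < N -> 0 <= xi -> N * lam + 4 * xi <= 1 + x ->
  xi * ((A + B) ^+ 2 / N) + lam * ((A ^+ 2 + B ^+ 2) / 2) <=
  (1 + x) / (2 * N) * (A ^+ 2 + B ^+ 2).
Proof.
move=> N0 xi0 Nlam.
have -> : (1 + x) / (2 * N) * (A ^+ 2 + B ^+ 2) = (1 + x) * ((A ^+ 2 + B ^+ 2) / N) / 2.
  by field; rewrite gt_eqF.
have -> : lam * ((A ^+ 2 + B ^+ 2) / 2) = N * lam * ((A ^+ 2 + B ^+ 2) / N) / 2.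
  by field; rewrite gt_eqF.
have h : (A + B) ^+ 2 / N <= 2 * ((A ^+ 2 + B ^+ 2) / N).
  by rewrite mulrA ler_pM2r ?invr_gt0 //; have := sqr_ge0 (A - B); lra.
have q0 : 0 <= (A ^+ 2 + B ^+ 2) / N by rewrite divr_ge0 ?addr_ge0 ?sqr_ge0 ?(ltW N0).
have := ler_wpM2l xi0 h; have := ler_wpM2r q0 Nlam.
by move: (_ / N) (_ / N) => q1 q2; lra.
Qed.

Lemma star_rate_bounds (N lam dl x xi : R) : 0 <= lam -> 0 < N -> 0 <= dl <= 1 -> 0 <= x <= 1 / 2 ->
  0 <= xi -> N * lam + 4 * xi <= 1 + x ->
  0 <= lam * (N * (1 - dl)) <= (1 + x) * (1 - dl) /\ 0 <= lam * (N * (1 - dl)) <= 2.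
Proof.
move=> l0 N0 /andP[d0 d1] /andP[x0 x1] xi0 h.
have a0 : 0 <= lam * (N * (1 - dl)) by rewrite !mulr_ge0 // ?subr_ge0 // ltW.
have a1 : lam * (N * (1 - dl)) <= (1 + x) * (1 - dl).
  by rewrite mulrCA mulrA; apply: ler_wpM2r; lra.
have a2 : (1 + x) * (1 - dl) <= (1 + x) * 1 by apply: ler_wpM2l; lra.
by rewrite a0 a1 /=; split=> //; lra.
Qed.

(** Once the summand is bounded by a nonnegative function of the overlap alone, the restriction to
    typical spins is dropped and [sum_overlap] applies. The gain of a star is lowered to [b], which
    will be chosen independently of [n]. *)
Lemma moment_sum_le n (W : {set 'I_n}) (p th chi g : R) (prb : bool -> R)
    (z kk b x t xi : R) :
  let N := n%:R : R in let w := #|W|%:R : R in let u := #|~: W|%:R : R in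
  let dl := w / N in let b' := b * expR (-2) in
  let tt := p * th / (1 - p) in let lam := th ^+ 2 * p / (1 - p) in
  let kap := block_error kk z in let sw := star_weight W p chi in
  (0 < n)%N -> (0 < #|W|)%N -> (2 <= #|~: W|)%N ->
  0 < p -> p <= 1 / 2 -> 0 < th -> th < 1 -> 0 <= chi -> chi <= 1 / 2 ->
  (forall c, prb c = p * (1 + th * sgn R c)) ->
  g * (1 - th) ^+ 2 = 4 * chi * (1 + tt) ^+ 2 -> 0 <= g <= 1 ->
  1 <= kk -> 0 < z -> small_deviation kk z -> 1 <= z * u -> 4 * tt <= z ->
  tt * u <= 2 * kk -> u * tt ^+ 2 <= z -> p * u <= kk ->
  6 * dl <= 1 -> 52 * dl <= b' -> 0 <= b <= 1 -> 0 <= x <= 1 / 2 -> 4 * x <= dl * b' ->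
  0 < t < 1 -> 1 - t <= dl * b' ->
  sw * gain1 th chi <= 1 -> b <= sw * gain2 th chi -> 
  sw * gain1 th chi + sw * gain2 th chi <= expR (-2) ->
  0 <= xi -> N * lam + 4 * xi <= 1 + x ->
  \sum_(s : spins n | `|mag R (~: W) s| <= z * u)
  \sum_(t : spins n | `|mag R (~: W) t| <= z * u)
    expR (xi * (inner R s t ^+ 2 / N)) *
    \prod_i block_moment p chi g prb (blk W i) (same_spin s) (same_spin t) <=
  2 ^+ n * (2 ^+ n * (2 * w + 1) * expR (2 * w * kap) * expR (t / (2 * (1 - t)))).
Proof.
move=> N w u dl b' tt lam kap sw n0 W0 U2 p0 p1 th0 th1 chi0 chi1 prE gE g01 kk1 z0 kz zm tz tm t2 pm.
move=> d6 d52 b01 x01 xb t01 tb swa swb swab xi0 Nlam.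
have swab' : sw * gain1 th chi + b <= expR (-2) by apply: le_trans swab; rewrite lerD2l.
have N0 : 0 < N by rewrite /N ltr0n.
have w0 : 0 < w by rewrite /w ltr0n.
have u0 : 0 < u by rewrite /u ltr0n (leq_trans _ U2).
have uE : u = N - w.
  have : N = w + u by rewrite /N /w /u -natrD cardsC card_ord.
  by lra.
have [l0 l1] := lam_bounds p0 p1 th0 th1; rewrite -/lam in l0 l1.
have kk0 : 0 <= kk by lra.
have kap0 : 0 <= kap by rewrite /kap block_error_ge0 // ltW.
have [/andP[g1 _] _] := gain_bounds th0 th1 chi0 chi1.
have sw0 : 0 <= sw.
  rewrite /sw /star_weight !mulr_ge0 ?exprn_ge0 ?invr_ge0 // ?ltW //; lra.
have a0 : 0 <= sw * gain1 th chi by exact: mulr_ge0.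
have /andP[b0 b1] := b01.
have dl0 : 0 < dl by rewrite /dl divr_gt0.
have uN : u = N * (1 - dl) by rewrite uE /dl; field; rewrite gt_eqF.
have dl01 : 0 <= dl <= 1 by rewrite (ltW dl0); lra.
have [al01 al2] := star_rate_bounds l0 N0 dl01 x01 xi0 Nlam; rewrite -uN in al01 al2.
have P0 y : `|y| <= 1 -> 0 <= Psi (lam * u) (sw * gain1 th chi) b kap y by exact: Psi_ge0.
pose F (r : spins n) := expR ((1 + x) / (2 * N) * (mag R W r ^+ 2 + mag R (~: W) r ^+ 2)) *
    \prod_(v in W) Psi (lam * u) (sw * gain1 th chi) b kap (spin R r v * (mag R (~: W) r / u)).
have zle (r : spins n) v : `|spin R r v * (mag R (~: W) r / u)| <= 1.
  rewrite normrM /spin norm_sgn mul1r normrM normfV (gtr0_norm u0).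
  by rewrite ler_pdivrMr // mul1r norm_mag_le.
have F0 r : 0 <= F r.
  by rewrite mulr_ge0 ?expR_ge0 //; apply: prodr_ge0 => v _; exact: P0.
apply: (@le_trans _ _ (\sum_(s : spins n) \sum_(t0 : spins n) F (overlap s t0))); last first.
  rewrite sum_overlap ler_pM2l ?exprn_gt0 //.
  case/andP: x01 => x0 _.
  apply: (@spin_sum_le R n W (lam * u) (sw * gain1 th chi) b (1 + x) x kap t) => //.
  by rewrite a0.
rewrite [leLHS]big_mkcond; apply: ler_sum => s _; case: ifP => ms; last first.
  by apply: sumr_ge0 => r _.
rewrite [leLHS]big_mkcond; apply: ler_sum => r _; case: ifP => mr; last exact: F0.
have gm := @graph_moment_le R n W p th chi g prb p0 p1 th0 th1 chi0 chi1 prE gE s r z kk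
  g01 U2 kk1 z0 kz zm tz tm t2 pm ms mr.
apply: le_trans (ler_wpM2l (expR_ge0 _) gm) _ => {gm}.
have P0' v : 0 <= Psi (lam * u) (sw * gain1 th chi) (sw * gain2 th chi) kap
    (spin R (overlap s r) v * (mag R (~: W) (overlap s r) / u)).
  by apply: Psi_ge0 => //; exact: le_trans swb.
rewrite [leLHS]mulrA -expRD /F; apply: ler_pM.
- exact: expR_ge0.
- by apply: prodr_ge0 => v _; exact: P0'.
- rewrite ler_expR /inner -/lam.
  have -> : mag R [set: 'I_n] (overlap s r) = mag R W (overlap s r) + mag R (~: W) (overlap s r).
    rewrite /mag (bigID (mem W)) /=; congr (_ + _); apply: eq_bigl => v; rewrite !inE //.
  move: (mag R W _) (mag R (~: W) _) => A B.
  exact: tilt_le.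
- apply: ler_prod => v _; rewrite -/kap -/sw -/u -/lam; apply/andP; split; last exact: Psi_le.
  exact: P0'.
Qed.
End MomentSum.

(** * A bound on the recovery probability for fixed [n] *)

Section Assembly.
Variable R : realType.

Lemma pow_le_expR (X : R) q : 0 <= X -> X ^+ q <= q%:R ^+ q * expR X.
Proof.
case: q => [|q] X0; first by rewrite !expr0 mul1r; have := expR_ge1Dx X; lra.
have q0 : 0 < q.+1%:R :> R by rewrite ltr0n.
have qn : q.+1%:R != 0 :> R by rewrite gt_eqF.
rewrite -[X in expR X](divfK qn) expRM_natr -exprMn.
apply: lerXn2r; rewrite ?nnegrE ?mulr_ge0 ?expR_ge0 ?(ltW q0) //.
rewrite -ler_pdivrMl // [_^-1 * X]mulrC.
by apply: le_trans (expR_ge1Dx _); rewrite lerDr.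
Qed.

Lemma atypical_le n (A : {set 'I_n}) (z : R) : 0 < z -> (0 < #|A|)%N ->
  \sum_(s : spins n | ~~ (`|mag R A s| <= z * #|A|%:R)) 2^-1 ^+ n <= (z ^+ 2 * #|A|%:R)^-1.
Proof.
move=> z0 A0; have u0 : 0 < #|A|%:R :> R by rewrite ltr0n.
apply: (@le_trans _ _ (\sum_(s : spins n) 2^-1 ^+ n * (mag R A s ^+ 2 / (z * #|A|%:R) ^+ 2))).
  rewrite big_mkcond; apply: ler_sum => s _; case: ifP => h; last first.
    by rewrite mulr_ge0 ?exprn_ge0 ?invr_ge0 // divr_ge0 ?sqr_ge0.
  rewrite -[leLHS]mulr1; apply: ler_wpM2l; first by rewrite exprn_ge0 // invr_ge0.
  rewrite ler_pdivlMr ?mul1r ?exprn_gt0 ?mulr_gt0 //.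
  rewrite -[leRHS]real_normK ?num_real //; apply: lerXn2r; rewrite ?nnegrE ?mulr_ge0 ?(ltW z0) //.
  by apply: ltW; rewrite ltNge.
rewrite -mulr_sumr -mulr_suml sum_mag_sqr mulrA mulrA -exprMn mulVf ?expr1n ?mul1r //.
by rewrite le_eqVlt; apply/orP; left; apply/eqP; field; rewrite !gt_eqF.
Qed.

(** Trading the power of the overlap for the tilt costs [(q * N / xi) ^ q], against
    [(dd * N) ^ (2 * q)] from the recovery threshold and [dd ^ (2 * q)] from the weight [y]. The
    condition on [q] makes the quotient at most [expR (- q)]; its fourth power is the two squares of
    [dd]. *)
Lemma recovery_bound n (W : {set 'I_n}) (a b0 p th chi g : R) (g01 : 0 <= g <= 1)
    (z kk b x t xi eta e : R) (q : nat) (est : graph n -> spins n) :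
  let N := n%:R : R in let w := #|W|%:R : R in let u := #|~: W|%:R : R in
  let dl := w / N in let b' := b * expR (-2) in
  let tt := p * th / (1 - p) in let lam := th ^+ 2 * p / (1 - p) in
  let kap := block_error kk z in let sw := star_weight W p chi in
  (0 < n)%N -> (0 < #|W|)%N -> (2 <= #|~: W|)%N ->
  0 < p -> p <= 1 / 2 -> 0 < th -> th < 1 -> 0 <= chi -> chi <= 1 / 2 ->
  (forall c, pr n a b0 c = p * (1 + th * sgn R c)) ->
  g * (1 - th) ^+ 2 = 4 * chi * (1 + tt) ^+ 2 ->
  1 <= kk -> 0 < z -> small_deviation kk z -> 1 <= z * u -> 4 * tt <= z ->
  tt * u <= 2 * kk -> u * tt ^+ 2 <= z -> p * u <= kk ->
  6 * dl <= 1 -> 52 * dl <= b' -> 0 <= b <= 1 -> 0 <= x <= 1 / 2 -> 4 * x <= dl * b' ->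
  0 < t < 1 -> 1 - t <= dl * b' ->
  sw * gain1 th chi <= 1 -> b <= sw * gain2 th chi -> 
  sw * gain1 th chi + sw * gain2 th chi <= expR (-2) ->
  0 < xi -> N * lam + 4 * xi <= 1 + x ->
  1 / 2 < eta -> 0 < e -> q%:R <= xi * (2 * eta - 1) ^+ 4 * expR (-1) * N ->
  \sum_(s : spins n) \sum_(G : graph n | partial_recovery eta s (est G))
    semirandom a b0 (star_adversary W g01) s G <=
  (z ^+ 2 * u)^-1 + e / 2 +
  expR (- q%:R) * ((2 * w + 1) * expR (2 * w * kap) * expR (t / (2 * (1 - t)))) / (2 * e).
Proof.
move=> N w u dl b' tt lam kap sw n0 W0 U2 p0 p1 th0 th1 chi0 chi1 prE gE kk1 z0 kz zm tz tm t2 pm.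
move=> d6 d52 b01 x01 xb t01 tb swa swb swab xi0 Nlam eta1 e0 qk.
set dd := 2 * eta - 1 in qk *.
have dd0 : 0 < dd by rewrite /dd; lra.
have N0 : 0 < N by rewrite /N ltr0n.
have pr01 := prb_bounds p0 p1 th0 th1 prE.
(* With this weight in the Cauchy-Schwarz step, the term of the reference law becomes exactly
   [e / 2]. *)
have y0 : 0 < dd ^+ (2 * q) * e by rewrite mulr_gt0 ?exprn_gt0.
have H := @recovery_le R n (semirandom a b0 (star_adversary W g01)) (ref_graph W p chi) est
  (fun s => `|mag R (~: W) s| <= z * u) eta _ q n0 eta1 y0
  (fun s G => @semirandom_ge0 R n W a b0 g g01 s G pr01) (@semirandom_sum R n W a b0 g g01)
  (fun G => @ref_graph_gt0 R n W p chi G p0 p1 chi0 chi1) (@ref_graph_sum R n W p chi).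
apply: le_trans H _; rewrite -/dd -/N -addrA; apply: lerD.
  by apply: atypical_le => //; exact: leq_trans U2.
rewrite mulrDr [leLHS]addrC; apply: lerD.
  rewrite exprMn le_eqVlt; apply/orP; left; apply/eqP.
  have n1 : dd ^+ (2 * q) != 0 by rewrite expf_neq0 // gt_eqF.
  have n2 : N ^+ (2 * q) != 0 by rewrite expf_neq0 // gt_eqF.
  by move: (dd ^+ (2 * q)) (N ^+ (2 * q)) n1 n2 => A B n1 n2; field; rewrite n1 n2.
have ms := @moment_sum_le R n W p th chi g (pr n a b0) z kk b x t xi n0 W0 U2 p0 p1 th0 th1
  chi0 chi1 prE gE g01 kk1 z0 kz zm tz tm t2 pm d6 d52 b01 x01 xb t01 tb swa swb swab (ltW xi0) Nlam.
rewrite -/N -/w -/u -/kap in ms.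
set y := dd ^+ (2 * q) * e in y0 *.
have y2 : 0 <= 2 * y by apply: mulr_ge0 => //; exact: ltW.
pose C := (q%:R * N / xi) ^+ q * 4^-1 ^+ n / (2 * y).
have C0 : 0 <= C.
  apply: divr_ge0 => //; apply: mulr_ge0; rewrite exprn_ge0 ?invr_ge0 //.
  by rewrite divr_ge0 ?mulr_ge0 ?(ltW N0) ?(ltW xi0).
have termle s r : inner R s r ^+ (2 * q) * (\sum_G semirandom a b0 (star_adversary W g01) s G *
     semirandom a b0 (star_adversary W g01) r G / ref_graph W p chi G) / (2 * y) <=
  C * (expR (xi * (inner R s r ^+ 2 / N)) *
    \prod_i block_moment p chi g (pr n a b0) (blk W i) (same_spin s) (same_spin r)).
  rewrite momentE /moment.
  have m0 : 0 <= \prod_i block_moment p chi g (pr n a b0) (blk W i) (same_spin s) (same_spin r).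
    by apply: prodr_ge0 => i _; apply: (block_moment_ge0 p0 p1 th0 th1 chi0 chi1 prE).
  move: (\prod_i _) m0 => mo m0.
  have pw : inner R s r ^+ (2 * q) <= (q%:R * N / xi) ^+ q * expR (xi * (inner R s r ^+ 2 / N)).
    have X0 : 0 <= xi * (inner R s r ^+ 2 / N).
      by rewrite mulr_ge0 ?divr_ge0 ?sqr_ge0 ?(ltW N0) ?(ltW xi0).
    have -> : inner R s r ^+ (2 * q) = (N / xi) ^+ q * (xi * (inner R s r ^+ 2 / N)) ^+ q.
      by rewrite exprM -exprMn; congr (_ ^+ _); field; rewrite !gt_eqF.
    have -> : (q%:R * N / xi) ^+ q = (N / xi) ^+ q * q%:R ^+ q.
      by rewrite -exprMn; congr (_ ^+ _); ring.
    rewrite -[leRHS]mulrA; apply: ler_wpM2l; last exact: pow_le_expR.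
    by rewrite exprn_ge0 // divr_ge0 ?ltW.
  have -> : C * (expR (xi * (inner R s r ^+ 2 / N)) * mo) =
    (q%:R * N / xi) ^+ q * expR (xi * (inner R s r ^+ 2 / N)) * (4^-1 ^+ n * mo / (2 * y)).
    by rewrite /C; ring.
  rewrite -[leLHS]mulrA; apply: ler_wpM2r => //.
  by apply: divr_ge0 => //; apply: mulr_ge0 => //; rewrite exprn_ge0 // invr_ge0.
have D0 : 0 < (dd * N) ^+ (2 * q) by rewrite exprn_gt0 // mulr_gt0.
rewrite mulrC ler_pdivrMr //.
apply: (@le_trans _ _ (C * (2 ^+ n * (2 ^+ n * (2 * w + 1) * expR (2 * w * kap) * expR (t / (2 * (1 - t))))))).
  apply: le_trans (ler_wpM2l C0 ms); rewrite mulr_sumr; apply: ler_sum => s _.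
  by rewrite mulr_sumr; apply: ler_sum => r _.
set Z := (2 * w + 1) * expR (2 * w * kap) * expR (t / (2 * (1 - t))).
have Z0 : 0 <= Z by rewrite !mulr_ge0 ?expR_ge0 // addr_ge0 // mulr_ge0.
have -> : C * (2 ^+ n * (2 ^+ n * (2 * w + 1) * expR (2 * w * kap) * expR (t / (2 * (1 - t))))) =
  (4^-1 ^+ n * 2 ^+ n * 2 ^+ n) * ((q%:R * N / xi) ^+ q * (Z / (2 * y))).
  by rewrite /C /Z; ring.
have -> : (4^-1 : R) ^+ n * 2 ^+ n * 2 ^+ n = 1.
  by rewrite -!exprMn (_ : 4^-1 * 2 * 2 = 1 :> R) ?expr1n //; field.
rewrite mul1r.
have -> : Z / (2 * y) = Z / (2 * e) / (dd ^+ 2) ^+ q.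
  have n1 : (dd ^+ 2) ^+ q != 0 by rewrite !expf_neq0 // gt_eqF.
  have n2 : e != 0 by rewrite gt_eqF.
  by rewrite /y exprM; move: ((dd ^+ 2) ^+ q) n1 => A n1; field; rewrite ?n1 ?n2.
have -> : expR (- q%:R) * Z / (2 * e) * (dd * N) ^+ (2 * q) =
  (expR (-1) * (dd * N) ^+ 2) ^+ q * (Z / (2 * e)).
  rewrite exprM [(expR (-1) * _) ^+ q]exprMn -[expR (-1) ^+ q]expRM_natr mulN1r.
  by move: (expR _) (((dd * N) ^+ 2) ^+ q) => A B; ring.
rewrite mulrCA mulrC; apply: ler_wpM2r; first by rewrite divr_ge0 // mulr_ge0 // ltW.
rewrite -expr_div_n; apply: lerXn2r; rewrite ?nnegrE.
- apply: divr_ge0; last exact: sqr_ge0.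
  by apply: divr_ge0; rewrite ?mulr_ge0 ?(ltW N0) ?(ltW xi0).
- by apply: mulr_ge0; [exact: expR_ge0|exact: sqr_ge0].
rewrite ler_pdivrMr ?exprn_gt0 // ler_pdivrMr //.
have -> : expR (-1) * (dd * N) ^+ 2 * dd ^+ 2 * xi = xi * dd ^+ 4 * expR (-1) * N * N by ring.
by rewrite ler_pM2r.
Qed.
End Assembly.

(** * Estimates uniform in the number of vertices *)

Section Asymptotics.
Variable R : realType.

Lemma expR_le_onem (p : R) : 0 <= p <= 1 / 2 -> expR (- (2 * p)) <= 1 - p.
Proof.
move=> /andP[p0 p1]; have := expR_mul_le1 (- (2 * p)).
by have := expR_gt0 (- (2 * p)); move: (expR _) => E; nra.
Qed.

Lemma expR_le_onemX (p : R) m : 0 <= p <= 1 / 2 -> expR (- (2 * p * m%:R)) <= (1 - p) ^+ m.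
Proof.
move=> p01; have [p0 p1] := andP p01.
rewrite -mulNr expRM_natr; apply: lerXn2r; rewrite ?nnegrE ?expR_ge0 ?expR_le_onem //; lra.
Qed.

(** The mean degree [p * u] of a star lies between [k / 2] and [k], so having exactly two edges
    keeps a probability bounded away from zero. Hence the gain of a star survives as [n] grows. *)
Lemma star_weight_bounds n (W : {set 'I_n}) (k chi : R) :
  let p := k / n%:R in let u := #|~: W|%:R : R in
  0 < k -> 2 * k <= n%:R -> n%:R <= 2 * u -> 0 <= chi ->
  chi * (k ^+ 2 / 8) * expR (- (2 * k)) <= star_weight W p chi <= chi * (k ^+ 2 / 2).
Proof.
move=> p u k0 kn nu chi0.
have n0 : 0 < n%:R :> R by lra.
have p0 : 0 < p by rewrite /p divr_gt0.
have p1 : p <= 1 / 2 by rewrite /p ler_pdivrMr //; lra.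
have pn : p * n%:R = k by rewrite /p divfK // gt_eqF.
have un : u <= n%:R by rewrite /u ler_nat -[X in (_ <= X)%N]card_ord max_card.
have u0 : 0 < u by lra.
have -> : star_weight W p chi = chi * ((p * u) ^+ 2 / 2 * (1 - p) ^+ (#|~: W| - 2)).
  by rewrite /star_weight /u; ring.
have pu1 : p * u <= k by rewrite -pn ler_pM2l.
have pu2 : k / 2 <= p * u by rewrite -pn -mulrA ler_pM2l //; lra.
have pw1 : (1 - p) ^+ (#|~: W| - 2) <= 1 by rewrite exprn_ile1 //; lra.
have pw0 : expR (- (2 * k)) <= (1 - p) ^+ (#|~: W| - 2).
  apply: le_trans (_ : expR (- (2 * p * (#|~: W| - 2)%:R)) <= _); last first.
    by apply: expR_le_onemX; rewrite (ltW p0).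
  rewrite ler_expR lerN2 -mulrA ler_pM2l //; apply: le_trans pu1.
  by rewrite ler_pM2l // /u ler_nat leq_subr.
have e0 := expR_gt0 (- (2 * k)).
have pu0 : 0 <= p * u by apply: mulr_ge0; exact: ltW.
have q1 : (p * u) ^+ 2 <= k ^+ 2 by apply: lerXn2r; rewrite ?nnegrE ?(ltW k0).
have q2 : (k / 2) ^+ 2 <= (p * u) ^+ 2 by apply: lerXn2r; rewrite ?nnegrE //; lra.
apply/andP; split.
  rewrite -mulrA; apply: ler_wpM2l => //; apply: ler_pM; rewrite ?(ltW e0) //.
    by rewrite divr_ge0 ?sqr_ge0.
  by rewrite expr_div_n in q2; lra.
apply: ler_wpM2l => //; rewrite -[leRHS]mulr1; apply: ler_pM => //.
- by rewrite divr_ge0 ?sqr_ge0.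
- by rewrite exprn_ge0 //; lra.
- by rewrite ler_pM2r.
Qed.

(** Half of the decay [kp * N] pays for the errors of the stars; the other half beats the linear
    factor through the quadratic term of the exponential series. The factor [expR 1] accounts for
    rounding [q] down. *)
Lemma tail_le (kp N w kap e T0 q : R) : 0 < kp -> 1 <= N -> 0 <= w <= N -> 0 < e ->
  0 <= T0 -> kp * N - 1 <= q -> 2 * w * kap <= kp * N / 2 ->
  48 * expR 1 * T0 / (kp ^+ 2 * e ^+ 2) <= N ->
  expR (- q) * ((2 * w + 1) * expR (2 * w * kap) * T0) / (2 * e) <= e / 4.
Proof.
move=> kp0 N1 /andP[w0 wN] e0 T00 qk wk hN.
have N0 : 0 < N by lra.
have h1 : expR (- q) * expR (2 * w * kap) <= expR 1 * expR (- (kp * N / 2)).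
  by rewrite -!expRD ler_expR; lra.
have h2 : expR (- (kp * N / 2)) * (kp ^+ 2 * N ^+ 2 / 8) <= 1.
  have : kp ^+ 2 * N ^+ 2 / 8 <= expR (kp * N / 2).
    have X0 : 0 <= kp * N / 2 by apply: divr_ge0 => //; apply: mulr_ge0; exact: ltW.
    have := @expR_ge1Dxn R (kp * N / 2) 1 X0.
    have -> : (kp * N / 2) ^+ 2 / 2`!%:R = kp ^+ 2 * N ^+ 2 / 8 by rewrite (_ : 2`!%N = 2%N) //; field.
    by lra.
  by move=> h; apply: le_trans (ler_wpM2l (expR_ge0 _) h) _; rewrite mulrC expRxMexpNx_1.
rewrite ler_pdivrMr ?ler_pdivrMr in hN *; rewrite ?mulr_gt0 ?exprn_gt0 //.
have -> : expR (- q) * ((2 * w + 1) * expR (2 * w * kap) * T0) =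
  (2 * w + 1) * T0 * (expR (- q) * expR (2 * w * kap)) by ring.
have c0 : 0 <= (2 * w + 1) * T0 by apply: mulr_ge0 => //; lra.
apply: le_trans (ler_wpM2l c0 h1) _.
have c1 : (2 * w + 1) * T0 <= 3 * N * T0 by apply: ler_wpM2r => //; lra.
have E1 := expR_gt0 (1 : R).
have E2 := expR_gt0 (- (kp * N / 2)).
have e12 : 0 <= expR 1 * expR (- (kp * N / 2)) by rewrite mulr_ge0 ?ltW.
apply: le_trans (ler_wpM2r e12 c1) _.
rewrite -(ler_pM2r (_ : 0 < kp ^+ 2 * N ^+ 2 / 8)); last by rewrite divr_gt0 // mulr_gt0 ?exprn_gt0.
have -> : 3 * N * T0 * (expR 1 * expR (- (kp * N / 2))) * (kp ^+ 2 * N ^+ 2 / 8) =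
  3 * N * T0 * expR 1 * (expR (- (kp * N / 2)) * (kp ^+ 2 * N ^+ 2 / 8)) by ring.
have c2 : 0 <= 3 * N * T0 * expR 1.
  by apply: mulr_ge0; [apply: mulr_ge0 => //; lra|exact: ltW].
apply: le_trans (ler_wpM2l c2 h2) _; rewrite mulr1.
have -> : 3 * N * T0 * expR 1 = 48 * expR 1 * T0 * (N / 16) by field.
have -> : e / 4 * (2 * e) * (kp ^+ 2 * N ^+ 2 / 8) = N * (kp ^+ 2 * e ^+ 2) * (N / 16) by field.
by apply: ler_wpM2r => //; lra.
Qed.

End Asymptotics.

(** * Vanishing of the recovery probability for fixed constants *)

Section Limit.
Variable R : realType.

Definition first_vertices (D n : nat) : {set 'I_n} := [set v : 'I_n | (v < n %/ D)%N].

Lemma card_first_vertices D n : #|first_vertices D n| = (n %/ D)%N.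
Proof.
have h : (n %/ D <= n)%N by exact: leq_div.
rewrite -sum1_card (eq_bigl (fun v : 'I_n => (v < n %/ D)%N)) => [|v]; last by rewrite inE.
by rewrite (big_ord_narrow h) sum1_card card_ord.
Qed.

(** The deletion probability solving [gE], truncated at one so that an adversary is defined for
    every [n]. *)
Definition cut_prob (p th chi : R) : R :=
  Num.min 1 (4 * chi * (1 + p * th / (1 - p)) ^+ 2 / (1 - th) ^+ 2).

Lemma cut_prob_bounds p th chi : 0 <= chi -> 0 <= cut_prob p th chi <= 1.
Proof.
move=> chi0; rewrite /cut_prob ge_min lexx /= andbT le_min ler01 /=.
by rewrite divr_ge0 ?sqr_ge0 // mulr_ge0 ?sqr_ge0 // mulr_ge0.
Qed.

Lemma first_vertices_bounds D n : (0 < D)%N -> (2 * D <= n)%N ->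
  let w := #|first_vertices D n|%:R : R in
  (0 < #|first_vertices D n|)%N /\ (n%:R <= 2 * D%:R * w /\ D%:R * w <= n%:R).
Proof.
move=> D0 Dn; rewrite card_first_vertices /=.
have E := divn_eq n D; have lt := ltn_pmod n D0.
have q0 : (0 < n %/ D)%N by rewrite divn_gt0 // (leq_trans _ Dn) // leq_pmull.
split => //; rewrite -!natrM !ler_nat; split; last by rewrite mulnC leq_trunc_div.
rewrite {1}E mulnAC mul2n -addnn [(n %/ D * D)%N]mulnC mulnDl mulnC leq_add2l.
by apply: leq_trans (ltnW lt) _; rewrite leq_pmull.
Qed.

(** Each summand in the lower bound on [N] serves one of the conclusions. The budget [1 + x] is
    spent as [x / 4] for [k * th ^ 2], [x / 4] for the factor [1 / (1 - p)] and [x / 2] for the tilt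
    with [xi = x / 8]. *)
Lemma large_n_bounds (k th z x N u w Dr : R) : 1 < k -> 0 < th < 1 -> 0 < z -> 0 < x <= 1 / 2 ->
  k * th ^+ 2 <= 1 + x / 4 -> N = w + u -> 6 <= Dr -> N <= 2 * Dr * w -> Dr * w <= N ->
  4 + 2 * k + 8 * k / z + 4 * k ^+ 2 / z + 8 * k / x + 2 / z <= N ->
  let p := k / N in let tt := p * th / (1 - p) in let lam := th ^+ 2 * p / (1 - p) in
  [/\ [/\ N <= 2 * u, 1 < u, 2 * k <= N & 1 <= N], [/\ 0 < p, p <= 1 / 2 & 1 <= z * u],
      [/\ 4 * tt <= z, tt * u <= 2 * k, u * tt ^+ 2 <= z & p * u <= k] ,
      0 <= tt <= 1 & N * lam + 4 * (x / 8) <= 1 + x].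
Proof.
move=> k1 /andP[th0 th1] z0 /andP[x0 x1] kth NE D6 wl wh big p tt lam.
have a1 : 0 < 8 * k / z by rewrite divr_gt0 //; lra.
have a2 : 0 < 4 * k ^+ 2 / z by rewrite divr_gt0 // mulr_gt0 ?exprn_gt0 //; lra.
have a3 : 0 < 8 * k / x by rewrite divr_gt0 //; lra.
have a4 : 0 < 2 / z by rewrite divr_gt0.
have N0 : 0 < N by lra.
have w0 : 0 < w.
  have : 0 < Dr * w by lra.
  by rewrite pmulr_rgt0 //; lra.
have w6 : 6 * w <= Dr * w by apply: ler_wpM2r => //; lra.
have pN : p * N = k by rewrite /p divfK // gt_eqF.
have p0 : 0 < p by rewrite /p divr_gt0 //; lra.
have p1 : p <= 1 / 2 by rewrite /p ler_pdivrMr //; lra.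
have pz : 8 * p <= z.
  rewrite /p mulrA ler_pdivrMr // -ler_pdivrMl // mulrC; lra.
have px : 8 * p <= x.
  rewrite /p mulrA ler_pdivrMr // -ler_pdivrMl // mulrC; lra.
have u0 : 0 < u by lra.
have q0 : 0 < 1 - p by lra.
have tt2 : tt <= 2 * p by rewrite /tt ler_pdivrMr //; nra.
have tt0 : 0 <= tt.
  by apply: divr_ge0; [apply: mulr_ge0|]; exact: ltW.
have pu : p * u <= k by rewrite -pN ler_pM2l //; lra.
have zu : 1 <= z * u.
  have : 2 / z <= N by lra.
  rewrite ler_pdivrMr // => h.
  have : z * N <= z * (2 * u) by rewrite ler_pM2l //; lra.
  by lra.
have ttu : tt * u <= 2 * k.
  have : tt * u <= 2 * p * u by apply: ler_wpM2r => //; exact: ltW.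
  by lra.
split; [split; lra|split=> //|split=> //|rewrite tt0; lra|].
- lra.
- have : 4 * k ^+ 2 / z <= N by lra.
  rewrite ler_pdivrMr // => h.
  have h2 : u * tt ^+ 2 <= N * (2 * p) ^+ 2.
    apply: ler_pM; rewrite ?sqr_ge0 ?(ltW u0) //; first lra.
    by apply: lerXn2r; rewrite ?nnegrE //; lra.
  apply: le_trans h2 _.
  have -> : N * (2 * p) ^+ 2 = 4 * k ^+ 2 / N by rewrite /p; field; rewrite gt_eqF.
  by rewrite ler_pdivrMr // [z * N]mulrC.
- have -> : N * lam = k * th ^+ 2 / (1 - p) by rewrite /lam -pN; field; rewrite gt_eqF.
  have : k * th ^+ 2 / (1 - p) <= 1 + x / 2.
    rewrite ler_pdivrMr //; apply: le_trans kth _.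
    have : p * x <= p * (1 / 2) by rewrite ler_pM2l.
    by lra.
  by lra.
Qed.

Lemma small_parameter (k kp : R) : 0 < k -> 0 < kp ->
  exists z : R, [/\ 0 < z, small_deviation k z & 2 * (block_error k z) <= kp / 2].
Proof.
move=> k0 kp0; pose C := 45 * k ^+ 3.
have C0 : 0 < C by apply: mulr_gt0 => //; exact: exprn_gt0.
pose y := Num.min (4 * k)^-1 (kp / (4 * C)).
have y0 : 0 < y.
  rewrite /y lt_min invr_gt0; apply/andP; split; first exact: mulr_gt0.
  by apply: divr_gt0 => //; exact: mulr_gt0.
exists (y / 207); rewrite /small_deviation /block_error.
have -> : 207 * (y / 207) = y by field.
split; first by rewrite divr_gt0 // ltr0n.
  by rewrite -ler_pdivlMl ?mulr_gt0 // mulr1 /y ge_min lexx.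
have : y <= kp / (4 * C) by rewrite /y ge_min lexx orbT.
rewrite ler_pdivlMr; last exact: mulr_gt0.
by rewrite -/C; lra.
Qed.

(* [w], [N], [D] are the number of star centres, of vertices, and their ratio. *)
Lemma ratio_bounds (b x t w N D : R) : 0 < w -> 0 < N -> 6 <= D -> 0 < b -> 0 <= x ->
  N <= 2 * D * w -> D * w <= N -> 52 <= b * D -> 8 * x * D <= b ->
  t = 1 - b / (2 * D) ->
  [/\ 6 * (w / N) <= 1, 52 * (w / N) <= b, 4 * x <= w / N * b & 1 - t <= w / N * b].
Proof.
move=> w0 N0 D6 b0 x0 wl wh Db xD tE.
have -> : w / N * b = w * b / N by ring.
have D0 : 0 < D by lra.
have h6 : 6 * w <= D * w by apply: ler_wpM2r => //; exact: ltW.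
have h52 : 52 * w <= b * D * w by apply: ler_wpM2r => //; exact: ltW.
have hb : b * (D * w) <= b * N by rewrite ler_pM2l.
have hx : 4 * x * N <= 4 * x * (2 * D * w) by apply: ler_wpM2l => //; lra.
have hx2 : 8 * x * D * w <= b * w by apply: ler_wpM2r => //; exact: ltW.
split.
- by rewrite mulrA ler_pdivrMr //; lra.
- by rewrite mulrA ler_pdivrMr //; lra.
- by rewrite ler_pdivlMr //; lra.
have -> : 1 - t = b / (2 * D) by rewrite tE; ring.
rewrite ler_pdivlMr // mulrAC ler_pdivrMr; last exact: mulr_gt0.
have : b * N <= b * (2 * D * w) by rewrite ler_pM2l.
by lra.
Qed.

Lemma edge_prob_small (c : R) n : 0 < n%:R :> R -> c <= n%:R -> edge_prob c n = c / n%:R.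
Proof.
move=> n0 cn; rewrite /edge_prob; apply/min_r.
by rewrite ler_pdivrMr // mul1r.
Qed.

Lemma cut_probE (p th chi : R) : 0 <= chi -> th < 1 -> 16 * chi <= (1 - th) ^+ 2 ->
  0 <= p * th / (1 - p) <= 1 ->
  cut_prob p th chi * (1 - th) ^+ 2 = 4 * chi * (1 + p * th / (1 - p)) ^+ 2.
Proof.
move=> chi0 th1 h; rewrite /cut_prob; move: (p * th / _) => tt /andP[t0 t1].
have d0 : 0 < (1 - th) ^+ 2 by rewrite exprn_gt0 // subr_gt0.
rewrite min_r; first by rewrite divfK // gt_eqF.
rewrite ler_pdivrMr // mul1r; apply: le_trans h.
have : (1 + tt) ^+ 2 <= 4 by nra.
by move=> h; apply: le_trans (ler_wpM2l _ h) _; [rewrite mulr_ge0|lra].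
Qed.

(** The constant [10] is half of [14 + 6], the bounds on the two gains. That [gain2] is nonnegative
    follows from [0 < b]. *)
Lemma weight_facts (sw s1 k chi b c th : R) : 0 <= chi -> 0 < b -> c <= 1 ->
  10 * chi * k ^+ 2 <= c -> 0 <= s1 <= sw -> sw <= chi * (k ^+ 2 / 2) ->
  b <= s1 * gain2 th chi -> 0 <= gain1 th chi <= 14 -> `|gain2 th chi| <= 6 ->
  [/\ sw * gain1 th chi <= 1, b <= sw * gain2 th chi &
      sw * gain1 th chi + sw * gain2 th chi <= c].
Proof.
move=> chi0 b0 c1 hc /andP[s10 s1w] sw1 bg /andP[g0 g1] g2.
have sw0 : 0 <= sw by exact: le_trans s1w.
have gg : 0 <= gain2 th chi.
  rewrite leNgt; apply/negP => gn.
  have : s1 * gain2 th chi <= 0 by apply: mulr_ge0_le0 => //; exact: ltW.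
  by lra.
rewrite ger0_norm // in g2.
have a1 : sw * gain1 th chi <= chi * (k ^+ 2 / 2) * 14 by exact: ler_pM.
have a2 : sw * gain2 th chi <= chi * (k ^+ 2 / 2) * 6 by exact: ler_pM.
have a3 : s1 * gain2 th chi <= sw * gain2 th chi by exact: ler_wpM2r.
have a4 : 0 <= sw * gain2 th chi by exact: mulr_ge0.
by split; lra.
Qed.

Lemma sbm_pair_prob (k th : R) n c : 0 < k -> 0 < th < 1 -> 2 * k <= n%:R ->
  pr n (k * (1 + th)) (k * (1 - th)) c = k / n%:R * (1 + th * sgn R c).
Proof.
move=> k0 /andP[th0 th1] kn; have N0 : 0 < n%:R :> R by lra.
have kt : k * th <= k * 1 by rewrite ler_pM2l // ltW.
have kt0 : 0 <= k * th by rewrite mulr_ge0 // ltW.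
by rewrite /pr /sgn; case: c; rewrite edge_prob_small //; [ring|lra|ring|lra].
Qed.

Lemma truncn_bounds (y : R) : 0 <= y ->
  (Num.truncn y)%:R <= y /\ y - 1 <= (Num.truncn y)%:R.
Proof.
move=> y0; have /andP[h1 h2] := truncn_itv y0; split=> //; move: h2.
by rewrite -natr1; lra.
Qed.

Lemma tail_weight_le (w N kap kp : R) : 0 <= kap -> 0 <= w <= N -> 2 * kap <= kp / 2 ->
  2 * w * kap <= kp * N / 2.
Proof.
move=> k0 /andP[w0 wN] h.
have k2 : 0 <= 2 * kap by exact: mulr_ge0.
have := ler_pM k2 w0 h wN; lra.
Qed.

Lemma chebyshev_term_le (z u N e : R) : 0 < z -> 0 < u -> N <= 2 * u -> 0 < e ->
  8 / (z ^+ 2 * e) <= N -> (z ^+ 2 * u)^-1 <= e / 4.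
Proof.
move=> z0 u0 nu e0; have z2 : 0 < z ^+ 2 by exact: exprn_gt0.
rewrite ler_pdivrMr; last exact: mulr_gt0.
move=> big; rewrite -[leLHS]mul1r ler_pdivrMr; last exact: mulr_gt0.
have : N * (z ^+ 2 * e) <= 2 * u * (z ^+ 2 * e) by rewrite ler_pM2r // mulr_gt0.
by lra.
Qed.

Section Eventually.
Variables (k th chi b x t : R) (D : nat).
Hypothesis chi0 : 0 <= chi.

Definition threshold_adversary n : monotone_adversary R n :=
  star_adversary (first_vertices D n) (cut_prob_bounds (k / n%:R) th chi0).

Local Open Scope classical_set_scope.

(** The exponent [q] and the deviation [z] depend on [eta], the adversary does not. The error [e] is
    split into [e / 4] for atypical spins, [e / 2] for the reference law and [e / 4] for the tilted
    second moment. *)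
Lemma threshold_adversary_cvg0 (eta : R) (est : estimator) :
  1 < k -> 0 < th < 1 -> chi <= 1 / 2 -> 16 * chi <= (1 - th) ^+ 2 ->
  10 * chi * k ^+ 2 <= expR (-2) -> 0 < b <= 1 ->
  b <= chi * (k ^+ 2 / 8) * expR (- (2 * k)) * gain2 th chi ->
  (6 <= D)%N -> 52 <= b * expR (-2) * D%:R -> 0 < x <= 1 / 2 ->
  8 * x * D%:R <= b * expR (-2) -> t = 1 - b * expR (-2) / (2 * D%:R) ->
  k * th ^+ 2 <= 1 + x / 4 -> 1 / 2 < eta ->
  recovery_prob (k * (1 + th)) (k * (1 - th)) threshold_adversary eta est n @[n --> \oo] --> (0 : R).
Proof.
move=> k1 th01 chi1 chith chik /andP[b0 b1] bg D6 Db /andP[x0 x1] xD tE kth eta1.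
have [th0 th1] := andP th01.
have k0 : 0 < k by lra.
have c0 := chi0.
have dd0 : 0 < 2 * eta - 1 by lra.
(* The rate for which [kp * n] is the largest exponent [q] that [recovery_bound] admits at
   [xi = x / 8]. *)
pose kp := x / 8 * (2 * eta - 1) ^+ 4 * expR (-1).
have kp0 : 0 < kp.
  by rewrite /kp mulr_gt0 ?expR_gt0 // mulr_gt0 ?exprn_gt0 //; lra.
have [z [z0 zk zC]] := small_parameter k0 kp0.
have D0 : (0 < D)%N by exact: leq_trans D6.
have Dr0 : 0 < D%:R :> R by rewrite ltr0n.
have e2 : 0 < (expR (-2) : R) <= 1 by rewrite expR_gt0 expR_le1; lra.
set b' := b * expR (-2) in Db xD tE.
have b'0 : 0 < b' by rewrite /b' mulr_gt0 // expR_gt0.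
have b'1 : b' <= 1 by case/andP: e2 => ? ?; rewrite /b'; apply: mulr_ile1 => //; exact: ltW.
have D6r : 6 <= D%:R :> R by rewrite (ler_nat R 6).
have t01 : 0 < t < 1.
  have : 0 < b' / (2 * D%:R) by rewrite divr_gt0 // mulr_gt0.
  have : b' / (2 * D%:R) < 1.
    rewrite ltr_pdivrMr ?mulr_gt0 // mul1r.
    by lra.
  by rewrite tE; move: (b' / _) => c ? ?; apply/andP; split; lra.
have [g1 g2] := gain_bounds th0 th1 c0 chi1.
apply/cvgrPdist_le => e e0.
pose T0 := expR (t / (2 * (1 - t))).
have T00 : 0 <= T0 by exact: expR_ge0.
near=> n.
have Dn : (2 * D <= n)%N by near: n; exact: nbhs_infty_ge.
have big : 4 + 2 * k + 8 * k / z + 4 * k ^+ 2 / z + 8 * k / x + 2 / z <= n%:R.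
  by near: n; exact: nbhs_infty_ger.
have big2 : 48 * expR 1 * T0 / (kp ^+ 2 * e ^+ 2) <= n%:R.
  by near: n; exact: nbhs_infty_ger.
have big3 : 8 / (z ^+ 2 * e) <= n%:R by near: n; exact: nbhs_infty_ger.
set W := first_vertices D n.
have [W0 [wl wh]] := first_vertices_bounds D0 Dn; rewrite -/W in W0 wl wh.
have NE : n%:R = #|W|%:R + #|~: W|%:R :> R by rewrite -natrD cardsC card_ord.
have x01 : 0 < x <= 1 / 2 by rewrite x0.
have := large_n_bounds k1 th01 z0 x01 kth NE D6r wl wh big.
set p := k / n%:R; set tt := p * th / (1 - p); set lam := th ^+ 2 * p / (1 - p).
move=> [[nu u1 kn N1] [p0 p1 zu] [tz tu ut pu] tt01 Nlam].
have [swl swu] := andP (star_weight_bounds (W := W) k0 kn nu c0).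
rewrite -/p in swl swu.
have N0 : 0 < n%:R :> R by exact: lt_le_trans N1.
have n0 : (0 < n)%N by rewrite -(ltr0n R).
have w0 : 0 < #|W|%:R :> R by rewrite ltr0n.
have u0 : 0 < #|~: W|%:R :> R by exact: lt_trans u1.
have U2 : (2 <= #|~: W|)%N by rewrite -(ltr_nat R).
have prE c : pr n (k * (1 + th)) (k * (1 - th)) c = p * (1 + th * sgn R c).
  exact: sbm_pair_prob.
have gE : cut_prob p th chi * (1 - th) ^+ 2 = 4 * chi * (1 + tt) ^+ 2 by exact: cut_probE.
have [d6 d52 dx dt] := ratio_bounds w0 N0 D6r b'0 (ltW x0) wl wh Db xD tE.
have s10 : 0 <= chi * (k ^+ 2 / 8) * expR (- (2 * k)) <= star_weight W p chi.
  by rewrite swl andbT !mulr_ge0 ?expR_ge0 ?exprn_ge0 ?invr_ge0 ?(ltW k0).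
have [swa swb swab] := weight_facts c0 b0 (proj2 (andP e2)) chik s10 swu bg g1 g2.
have b01 : 0 <= b <= 1 by rewrite ltW.
have x01' : 0 <= x <= 1 / 2 by rewrite ltW.
have xi0 : 0 < x / 8 by rewrite divr_gt0.
have kn0 : 0 <= kp * n%:R by rewrite mulr_ge0 ?ltW.
have [qu ql] := truncn_bounds kn0.
have rb := @recovery_bound R n W (k * (1 + th)) (k * (1 - th)) p th chi _
  (cut_prob_bounds p th chi0) z k b x t (x / 8) eta e (Num.truncn (kp * n%:R)) (est n)
  n0 W0 U2 p0 p1 th0 th1 c0 chi1 prE gE (ltW k1) z0 zk
  zu tz tu ut pu d6 d52 b01 x01' dx t01 dt swa swb swab xi0 Nlam eta1 e0 qu.
have pr01 := prb_bounds p0 p1 th0 th1 prE.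
rewrite sub0r normrN ger0_norm; last first.
  by apply: sumr_ge0 => s _; apply: sumr_ge0 => G _; exact: semirandom_ge0.
apply: le_trans rb _.
have wN : 0 <= (#|W|%:R : R) <= n%:R by rewrite (ltW w0) NE lerDl ltW.
have kap0 : 0 <= block_error k z by apply: block_error_ge0; exact: ltW.
have tl := tail_le kp0 N1 wN e0 T00 ql (tail_weight_le kap0 wN zC) big2; rewrite -/T0.
have ch := chebyshev_term_le z0 u0 nu e0 big3.
have eE : e = e / 4 + e / 2 + e / 4 by field.
by rewrite [leRHS]eE; exact: lerD (lerD ch (lexx _)) tl.
Unshelve. all: by end_near.
Qed.

End Eventually.
End Limit.

(** * Choice of the constants and conclusion *)

Lemma expRN2_ge (R : realType) : 1 / 16 <= expR (-2) :> R.
Proof.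
have h : 1 / 2 <= expR (- (1 / 2)) :> R by have := expR_ge1Dx (- (1 / 2) : R); lra.
have -> : expR (-2) = expR (- (1 / 2)) ^+ 4 :> R by rewrite -expRM_natr; congr expR; field.
have -> : 1 / 16 = (1 / 2) ^+ 4 :> R by field.
by apply: lerXn2r; rewrite ?nnegrE ?expR_ge0 //; lra.
Qed.

(** For [th <= 1] one has [2 * th ^ 2 - th ^ 4 >= th ^ 2], and [chi] takes away at most half of it.
    The bound depends on [th0] only, so it is available before [th] is fixed. *)
Lemma gain2_ge (R : realType) (th th0 chi : R) : 0 < th0 <= th -> th < 1 -> 0 <= chi ->
  2 * chi <= th0 ^+ 2 -> th0 ^+ 2 / 2 <= gain2 th chi.
Proof.
move=> /andP[t0 tt] t1 c0 ct; rewrite /gain2.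
have h1 : th0 ^+ 2 <= th ^+ 2 by apply: lerXn2r; rewrite ?nnegrE //; lra.
have h2 : th ^+ 2 <= 1 by rewrite expr_le1 //; lra.
have h0 : 0 <= th0 ^+ 2 by exact: sqr_ge0.
rewrite ler_pdivlMr; last by lra.
rewrite (_ : th ^+ 4 = th ^+ 2 * th ^+ 2); last by ring.
by move: (th ^+ 2) (th0 ^+ 2) h1 h2 h0 ct => a c h1 h2 h0 ct; nra.
Qed.

Lemma near_threshold (R : realType) (k t0 x : R) : k * t0 ^+ 2 = 1 -> 0 < t0 -> t0 < 1 ->
  0 < x -> 8 * x <= 1 - t0 ->
  exists th : R, [/\ t0 <= th, th < 1, (1 - t0) ^+ 2 <= 4 * (1 - th) ^+ 2,
    k * th ^+ 2 <= 1 + x / 4 & 1 < k * th ^+ 2].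
Proof.
move=> kt t00 t01 x0 xt; exists (t0 * (1 + x / 16)).
have tx0 : 0 < t0 * x by exact: mulr_gt0.
have tx : t0 * x <= x by rewrite ler_piMl ?ltW.
have -> : k * (t0 * (1 + x / 16)) ^+ 2 = (1 + x / 16) ^+ 2.
  by rewrite exprMn mulrA kt mul1r.
have x2 := sqr_ge0 x; have xx : x ^+ 2 <= x by rewrite expr2 ler_piMl; lra.
split; try lra.
have -> : 4 * (1 - t0 * (1 + x / 16)) ^+ 2 = (2 * (1 - t0 * (1 + x / 16))) ^+ 2 by ring.
by apply: lerXn2r; rewrite ?nnegrE; lra.
Qed.

(* [t0 = k^(-1/2)] is the threshold value; [chi], [b], [D], [x] are chosen in
   this order, and [th] last, slightly above [t0]. *)
Lemma threshold_constants (R : realType) (k : R) : 1 < k ->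
  exists th chi b x : R, exists D : nat,
  [/\ [/\ 0 < th < 1, 0 <= chi, chi <= 1 / 2, 16 * chi <= (1 - th) ^+ 2 &
          10 * chi * k ^+ 2 <= expR (-2)],
      [/\ 0 < b <= 1, b <= chi * (k ^+ 2 / 8) * expR (- (2 * k)) * gain2 th chi,
          (6 <= D)%N & 52 <= b * expR (-2) * D%:R] &
      [/\ 0 < x <= 1 / 2, 8 * x * D%:R <= b * expR (-2),
          k * th ^+ 2 <= 1 + x / 4 & 1 < k * th ^+ 2]].
Proof.
move=> k1; pose t0 : R := (Num.sqrt k)^-1.
have k0 : 0 < k by lra.
have s1 : 1 < Num.sqrt k by rewrite -[ltLHS]sqrtr1 ltr_sqrt.
have t00 : 0 < t0 by rewrite invr_gt0; lra.
have t01 : t0 < 1 by rewrite invf_lt1 //; lra.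
have kt : k * t0 ^+ 2 = 1.
  by rewrite /t0 exprVn sqr_sqrtr ?(ltW k0) // mulfV // gt_eqF.
pose gp := 1 - t0.
have [gp0 gp1] : 0 < gp /\ gp < 1 by rewrite /gp; split; lra.
have t2 : 0 < t0 ^+ 2 <= 1 by rewrite exprn_gt0 //= expr_le1 //; lra.
have gp2 : 0 < gp ^+ 2 <= 1 by rewrite exprn_gt0 //= expr_le1 //; lra.
have k2 : 1 <= k ^+ 2 by rewrite expr_ge1 //; lra.
(* The constant [160] yields [10 * chi * k ^ 2 <= 1 / 16 <= expR (-2)]. The factor [t0 ^ 2] serves
   [gain2_ge], and [gp ^ 2] makes the deletion probability at most one. *)
pose chi := t0 ^+ 2 * gp ^+ 2 / (160 * k ^+ 2).
have ck : chi * k ^+ 2 = t0 ^+ 2 * gp ^+ 2 / 160.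
  by rewrite /chi; field; rewrite gt_eqF.
have chi0 : 0 < chi.
  case/andP: t2 => ? _; case/andP: gp2 => ? _.
  by rewrite /chi divr_gt0 ?mulr_gt0 //; lra.
have cle : chi <= t0 ^+ 2 * gp ^+ 2 / 160 by rewrite -ck ler_peMr // ltW.
have tg1 : t0 ^+ 2 * gp ^+ 2 <= gp ^+ 2.
  by case/andP: t2 => *; rewrite ler_piMl // sqr_ge0.
have tg2 : t0 ^+ 2 * gp ^+ 2 <= t0 ^+ 2.
  by case/andP: gp2 => *; rewrite ler_piMr // sqr_ge0.
have co : 160 * chi <= gp ^+ 2 by lra.
have ct : 160 * chi <= t0 ^+ 2 by lra.
have ck1 : 160 * (chi * k ^+ 2) <= 1 by rewrite ck; case/andP: t2; lra.
have E0 := expR_gt0 (- (2 * k)); have E1 : expR (- (2 * k)) <= 1 by rewrite expR_le1; lra.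
(* The last factor is the lower bound of [gain2_ge] at [t0], valid for every later choice of [th]
   above [t0]. *)
pose b := chi * (k ^+ 2 / 8) * expR (- (2 * k)) * (t0 ^+ 2 / 2).
have c00 : 0 < chi * (k ^+ 2 / 8) * expR (- (2 * k)).
  by rewrite mulr_gt0 // mulr_gt0 // divr_gt0 //; lra.
have b01 : 0 < b <= 1.
  case/andP: t2 => t2 t2'.
  have h2 : 0 < t0 ^+ 2 / 2 by lra.
  have h3 : t0 ^+ 2 / 2 <= 1 by lra.
  rewrite /b; apply/andP; split; first exact: mulr_gt0.
  have c8 : 0 <= chi * (k ^+ 2 / 8) by apply: mulr_ge0; [exact: ltW|lra].
  have c9 : chi * (k ^+ 2 / 8) <= 1 by lra.
  rewrite -[leRHS]mulr1 -[X in _ <= X * _]mulr1.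
  by apply: ler_pM => //; [exact: ltW|exact: ltW|exact: ler_pM c8 (ltW E0) c9 E1].
have e2 := expR_gt0 (-2 : R).
have e21 : expR (-2) <= 1 :> R by rewrite expR_le1; lra.
have b'0 : 0 < b * expR (-2) by case/andP: b01 => *; rewrite mulr_gt0.
have b'1 : b * expR (-2) <= 1 by case/andP: b01 => *; apply: mulr_ile1 => //; exact: ltW.
have [D D6 Db] : exists2 D : nat, (6 <= D)%N & 52 <= b * expR (-2) * D%:R.
  exists ((Num.truncn (52 / (b * expR (-2)))).+1 + 6)%N; first exact: leq_addl.
  rewrite mulrC -ler_pdivrMr //.
  apply: le_trans (ltW (truncnS_gt _)) _; rewrite ler_nat.
  exact: leq_addr.
have Dr : 6 <= D%:R :> R by rewrite (ler_nat R 6).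
(* The factor [gp] ensures [8 * x <= 1 - t0], so that raising [th] above [t0] at most halves its
   distance to one. *)
pose x := b * expR (-2) * gp / (8 * D%:R).
have D0 : 0 < D%:R :> R by exact: lt_le_trans Dr.
have x0 : 0 < x by apply: divr_gt0; exact: mulr_gt0.
have xD : 8 * x * D%:R = b * expR (-2) * gp.
  by rewrite /x; field; rewrite gt_eqF.
have bo : b * expR (-2) * gp <= gp by rewrite ler_piMl // ltW.
have xo : 8 * x <= gp.
  have : 8 * x * 1 <= 8 * x * D%:R by apply: ler_wpM2l; lra.
  by lra.
have [th [thl th1 thg kth kth1]] := near_threshold kt t00 t01 x0 xo.
exists th, chi, b, x, D; split.
- split.
  + by rewrite th1 andbT (lt_le_trans t00).
  + exact: ltW.
  + by case/andP: t2; lra.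
  + by rewrite -/gp in thg; lra.
  + by apply: le_trans (expRN2_ge R); lra.
- split=> //.
  rewrite /b; apply: ler_wpM2l; first exact: ltW.
  apply: gain2_ge => //; [by rewrite t00|exact: ltW|].
  by case/andP: t2; lra.
- split.
  + by rewrite x0; lra.
  + by rewrite xD ler_piMr // ltW.
  + exact: kth.
  + exact: kth1.
Qed.

Local Open Scope classical_set_scope.

Theorem theorem1 (R : realType) (k : R) (hk : 1 < k) :
  exists eps : R,
    [/\ 0 < eps, eps < 1 / 2, 1 < k * (1 - 2 * eps) ^+ 2 &
      let a := 2 * k * (1 - eps) in
      let b := 2 * k * eps in
      exists A : forall n : nat, monotone_adversary R n,
        (forall (eta : R), 1 / 2 < eta ->
          forall est : estimator,
            recovery_prob a b A eta est n @[n --> \oo] --> (0 : R)) /\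
        ~ (exists est : estimator, achieves_partial_recovery a b A est)].
Proof.
have [th [chi [b [x [D [[th01 chi0 chi1 chith chik] [b01 bg D6 Db] [x01 xD kth kth1]]]]]]] :=
  threshold_constants hk.
have [t0 t1] := andP th01.
exists ((1 - th) / 2); split; [lra|lra| |].
  by rewrite (_ : 1 - 2 * _ = th) //; field.
have -> : 2 * k * (1 - (1 - th) / 2) = k * (1 + th) by field.
have -> : 2 * k * ((1 - th) / 2) = k * (1 - th) by field.
move=> a b2; exists (threshold_adversary k th D chi0).
have lim eta est : 1 / 2 < eta ->
    recovery_prob a b2 (threshold_adversary k th D chi0) eta est n @[n --> \oo] --> (0 : R).
  move=> he.
  by apply: (@threshold_adversary_cvg0 R k th chi b x (1 - b * expR (-2) / (2 * D%:R)) D chi0).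
split; first by move=> eta he est; exact: lim.
move=> [est [eta he h1]]; have h0 := lim eta est he.
have e10 : (1 : R) = 0.
  exact: etrans (esym (cvg_lim (@norm_hausdorff _ _) h1)) (cvg_lim (@norm_hausdorff _ _) h0).
by move: (oner_neq0 R); rewrite e10 eqxx.
Qed.
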